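(* Let $N\ge 1$ be an integer, let $p>1$, $T>0$, let $l_1$ be any positive number (integer or noninteger), let $l_2>l_1$ be a positive noninteger, and let $\Omega\subset\mathbb{R}^N$ be a domain (bounded or unbounded) with smooth boundary (of class $C^{l_2}$). Put $\Omega_T=\Omega\times(0,T)$ and $\overline{\Omega}_T=\overline{\Omega}\times[0,T]$. Then there is a constant $C>0$, depending only on the fixed data $N,\Omega,T,p,l_1,l_2$ and not on $u$, such that for every $u(x,t)\in C^{l_2,\frac{l_2}{2}}(\overline{\Omega}_T)\cap L_p(\Omega_T)$ the following hold. (i) One has $$|u|^{(l_1)}_{\overline{\Omega}_T}\le C\left(|u|^{(l_2)}_{\overline{\Omega}_T}\right)^{\omega}\left(\|u\|_{p,\Omega_T}\right)^{1-\omega},\qquad \omega=\frac{pl_1+N+2}{pl_2+N+2}.$$ (ii) If, in addition, $\sup_{0<t<T}\|u(\cdot,t)\|_{p,\Omega}<\infty$, then $$|u|^{(l_1)}_{\overline{\Omega}_T}\le C\left(|u|^{(l_2)}_{\overline{\Omega}_T}\right)^{\sigma}\left(\sup_{0<t<T}\|u(\cdot,t)\|_{p,\Omega}\right)^{1-\sigma},\qquad \sigma=\frac{pl_1+N}{pl_2+N}.$$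
   Context: $\|\cdot\|_{p,\Omega}$ and $\|\cdot\|_{p,\Omega_T}$ denote the norms of the Lebesgue spaces $L_p(\Omega)$ and $L_p(\Omega_T)$. Parabolic Hölder spaces. For an integer $m\ge 0$ put $$|u|^{(m)}_{\overline{\Omega}_T}=\sum_{|\overline{\beta}|+2j\le m}\ \max_{\overline{\Omega}_T}\left|D_t^jD_x^{\overline{\beta}}u(x,t)\right|,$$ where $\overline{\beta}=(\beta_1,\dots,\beta_N)$ is a multiindex with $|\overline\beta|=\beta_1+\dots+\beta_N$ and $j\ge 0$ is an integer (the maximum is understood as a supremum when $\Omega$ is unbounded). This is the meaning of $|u|^{(l_1)}_{\overline{\Omega}_T}$ when $l_1$ is an integer. For $\gamma\in(0,1)$ let $$\langle w\rangle^{(\gamma)}_{x,\overline{\Omega}_T}=\sup\frac{|w(x,t)-w(y,t)|}{|x-y|^{\gamma}},\qquad \langle w\rangle^{(\gamma)}_{t,\overline{\Omega}_T}=\sup\frac{|w(x,t)-w(x,\tau)|}{|t-\tau|^{\gamma}},$$ the suprema being over distinct points of $\overline{\Omega}_T$ of the indicated form. For noninteger $l=m+\alpha$, with $m\ge 0$ an integer and $\alpha\in(0,1)$, the space $C^{l,\frac{l}{2}}(\overline{\Omega}_T)$ consists of the functions with finite norm $$|u|^{(l)}_{\overline{\Omega}_T}=|u|^{(m)}_{\overline{\Omega}_T}+\langle u\rangle^{(l)}_{x,\overline{\Omega}_T}+\langle u\rangle^{(l)}_{t,\overline{\Omega}_T},$$ where $$\langle u\rangle^{(m+\alpha)}_{x,\overline{\Omega}_T}=\sum_{0\le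 m-|\overline{\beta}|-2j\le 1}\left\langle D_t^jD_x^{\overline{\beta}}u\right\rangle^{(\alpha)}_{x,\overline{\Omega}_T},\qquad \langle u\rangle^{(m+\alpha)}_{t,\overline{\Omega}_T}=\sum_{0\le m-|\overline{\beta}|-2j\le 1}\left\langle D_t^jD_x^{\overline{\beta}}u\right\rangle^{\left(\frac{m-|\overline{\beta}|-2j+\alpha}{2}\right)}_{t,\overline{\Omega}_T}.$$
   Formalization: Smooth boundary of class C^{l2} is taken uniformly: charts of a fixed radius with C^1 and C^{l2} norms bounded independently of the boundary point; otherwise the claim fails for unbounded domains thinning at infinity and, when l2<1, for domains with cusps. *)

(* Defs.v *)
From HB Require Import structures.
From mathcomp Require Import all_boot all_order all_algebra.
From mathcomp Require Import all_classical all_reals all_analysis.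

Set Implicit Arguments.
Unset Strict Implicit.
Unset Printing Implicit Defensive.

Import Order.TTheory GRing.Theory Num.Theory.
Import numFieldNormedType.Exports.

Local Open Scope classical_set_scope.
Local Open Scope ring_scope.

Section lebesgue_tuple.
Context {R : realType}.
Notation mR := (measurableTypeR R).

Definition cons_pair n (z : mR * n.-tuple mR) : n.+1.-tuple mR :=
  [the n.+1.-tuple mR of z.1 :: z.2].

Lemma measurable_cons_pair n : measurable_fun [set: mR * n.-tuple mR] (@cons_pair n).
Proof. by apply: measurable_cons. Qed.

Section lebS.
Variables (n : nat) (mu : {sigma_finite_measure set (n.-tuple mR) -> \bar R}).

Definition lebS : set (n.+1.-tuple mR) -> \bar R :=
  pushforward (@lebesgue_measure R \x mu)%E (@cons_pair n).

Let lebS0 : lebS set0 = 0%E.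
Proof. by rewrite /lebS /pushforward preimage_set0 measure0. Qed.

Let lebS_ge0 A : (0 <= lebS A)%E.
Proof. by rewrite /lebS /pushforward measure_ge0. Qed.

Let lebS_semi_sigma_additive : semi_sigma_additive lebS.
Proof.
have mc := @measurable_cons_pair n.
rewrite /lebS => F mF tF mUF; rewrite /pushforward preimage_bigcup.
apply: measure_semi_sigma_additive.
- by move=> k; rewrite -[X in measurable X]setTI; exact: mc.
- apply/trivIsetP => /= i j _ _ ij; rewrite -preimage_setI.
  by move/trivIsetP : tF => /(_ _ _ _ _ ij) ->//; rewrite preimage_set0.
- by rewrite -preimage_bigcup -[X in measurable X]setTI; exact: mc.
Qed.

HB.instance Definition _ :=
  isMeasure.Build _ _ _ lebS lebS0 lebS_ge0 lebS_semi_sigma_additive.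

Let lebS_sigma_finite : sigma_finite setT lebS.
Proof.
have [F FT Ffin] : sigma_finite setT (@lebesgue_measure R \x mu)%E.
  have /sigma_finiteP[F [TF ndF Foo]] := sigma_finiteT (@lebesgue_measure R).
  have /sigma_finiteP[G [TG ndG Goo]] := sigma_finiteT mu.
  exists (fun k => F k `*` G k).
    rewrite -setXTT TF TG predeqE => -[x y]; split.
      move=> [/= [i _ Fx] [j _ Gy]]; exists (maxn i j) => //; split.
      - by move: x Fx; exact/subsetPset/ndF/leq_maxl.
      - by move: y Gy; exact/subsetPset/ndG/leq_maxr.
    by move=> [k _ []/= ? ?]; split; exists k.
  move=> k; have [? ?] := Foo k; have [? ?] := Goo k.
  split; first exact: measurableX.
  by rewrite product_measure1E// lte_mul_pinfty// ge0_fin_numE.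
pose g (y : n.+1.-tuple mR) : mR * n.-tuple mR := (thead y, [tuple of behead y]).
have gK : cancel (@cons_pair n) g.
  by move=> [x y]; rewrite /g; congr pair; exact: val_inj.
have mg : measurable_fun setT g.
  by apply/measurable_fun_pair; [exact: measurable_tnth|exact: measurable_behead].
exists (fun k => g @^-1` F k); first by rewrite -preimage_bigcup -FT preimage_setT.
move=> k; have [mF Fk] := Ffin k; split.
  by rewrite -[X in measurable X]setTI; exact: mg.
rewrite /lebS /pushforward -comp_preimage.
by rewrite (_ : g \o @cons_pair n = id) //; apply/funext.
Qed.

HB.instance Definition _ :=
  Measure_isSigmaFinite.Build _ _ _ lebS lebS_sigma_finite.
End lebS.

(* The Lebesgue measure of R^n, on n-tuples: the product of n copies of the
   one-dimensional one. *)
Fixpoint leb n : {sigma_finite_measure set (n.-tuple mR) -> \bar R} :=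
  if n is k.+1 then lebS (leb k) else dirac ([tuple] : 0.-tuple mR).

End lebesgue_tuple.

Section derivatives.
Context {R : realType} {V : normedModType R}.

(* [dderiv [:: v1; ..; vk] f] is D_{v1} (... (D_{vk} f)). *)
Definition dderiv (vs : seq V) (f : V -> R) : V -> R :=
  foldr (fun v g => 'D_v g) f vs.

(* All the derivatives taken successively in [dderiv vs f] exist on [U]. *)
Fixpoint dderivable (U : set V) (vs : seq V) (f : V -> R) : Prop :=
  if vs is v :: vs' then
    dderivable U vs' f /\ forall z, U z -> derivable (dderiv vs' f) z v
  else True.

End derivatives.

(* The directions of D^beta, for a multiindex beta in the directions [e]. *)
Definition multi_dirs (V : Type) n (e : 'I_n -> V) (beta : 'I_n -> nat) : seq V :=
  flatten [seq nseq (beta i) (e i) | i <- enum 'I_n].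

Definition msize n (beta : 'I_n -> nat) : nat := (\sum_i beta i)%N.

(* A multiindex with all its entries at most [m]; only this finite range of
   multiindices occurs in the norms of order [m]. *)
Notation multiindex n m := {ffun 'I_n -> 'I_m.+1}.

Definition entries n m (beta : multiindex n m) : 'I_n -> nat := fun i => beta i.

(* The norm of ['rV[R]_n] in the library is the maximum norm. *)
Definition enorm {R : realType} n (x : 'rV[R]_n) : R :=
  Num.sqrt (\sum_i (x 0 i) ^+ 2).

Definition eball {R : realType} n (r : R) : set 'rV[R]_n := [set x | enorm x < r].

Section elliptic_hoelder.
Context {R : realType} {n : nat}.
Implicit Types (D : set 'rV[R]_n) (h : 'rV[R]_n -> R).

Definition Dx (beta : 'I_n -> nat) h : 'rV[R]_n -> R :=
  dderiv (multi_dirs (fun i => delta_mx 0 i) beta) h.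

Definition C_on D (m : nat) h : Prop :=
  forall beta : 'I_n -> nat, (msize beta <= m)%N ->
    dderivable D (multi_dirs (fun i => delta_mx 0 i) beta) h /\
    forall y, D y -> {for y, continuous (Dx beta h)}.

Local Open Scope ereal_scope.

Definition sup_on D h : \bar R := ereal_sup [set `|h y|%:E | y in D].

(* The maximum with 0 only matters when [D] has no two distinct points, as is
   the case in dimension [n = 0]. *)
Definition hoelder_on D (gamma : R) h : \bar R :=
  maxe 0 (ereal_sup [set (`|h z.1 - h z.2| / enorm (z.1 - z.2) `^ gamma)%:E
    | z in [set z : 'rV[R]_n * 'rV[R]_n | D z.1 /\ D z.2 /\ z.1 != z.2]]).

(* The norm of C^l(D), for l an integer or not. *)
Definition hnorm D (l : R) h : \bar R :=
  let m := Num.truncn l in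
  let al := (l - m%:R)%R in
  \sum_(beta : multiindex n m | (msize (entries beta) <= m)%N)
    sup_on D (Dx (entries beta) h) +
  if l \is a Num.int then 0 else
    \sum_(beta : multiindex n m |
          (msize (entries beta) <= m <= (msize (entries beta)).+1)%N)
      hoelder_on D al (Dx (entries beta) h).

Definition C_bounded D (l K : R) h : Prop :=
  C_on D (Num.truncn l) h /\ hnorm D l h <= K%:E.

End elliptic_hoelder.

Section domains.
Context {R : realType} {N : nat}.
Implicit Types Omega : set 'rV[R]_N.

Definition domain Omega : Prop := [/\ open Omega, connected Omega & Omega !=set0].

(* The boundary of [Omega] is smooth of class C^l, uniformly: in the ball of
   radius [rho] about any boundary point, and in suitable orthonormal
   coordinates y, [Omega] is the part y_k > h(y') above the graph of a function
   h of the N - 1 other coordinates y' = [col' k y], with C^1 and C^l norms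
   bounded by [K], where [rho] and [K] do not depend on the boundary point.  By
   compactness, [rho] and [K] come for free when [Omega] is bounded; without
   them, an unbounded domain with smooth boundary could get arbitrarily thin at
   infinity.  The bound in C^1 is only relevant for l < 1. *)
Definition smooth_boundary (l : R) Omega : Prop :=
  exists rho K : R, 0 < rho /\
  forall x0, (closure Omega `\` interior Omega) x0 ->
  exists (Q : 'M[R]_N) (k : 'I_N) (h : 'rV[R]_N.-1 -> R),
    [/\ Q *m Q^T = 1%:M,
        C_bounded (eball rho) 1 K h,
        C_bounded (eball rho) l K h &
        forall y, eball rho y -> Omega (x0 + y *m Q) <-> h (col' k y) < y 0 k].

End domains.

Section parabolic.
Context {R : realType} {N : nat}.
Variables (Omega : set 'rV[R]_N) (T : R).
Implicit Types (u w : 'rV[R]_N * R -> R) (beta : 'I_N -> nat).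

Definition cyl : set ('rV[R]_N * R) := Omega `*` `]0, T[%classic.
Definition ccyl : set ('rV[R]_N * R) := closure Omega `*` `[0, T]%classic.

Definition par_order (j : nat) beta : nat := (msize beta + 2 * j)%N.

(* D_t^j D_x^beta *)
Definition par_dirs (j : nat) beta : seq ('rV[R]_N * R) :=
  nseq j (0, 1) ++ multi_dirs (fun i => (delta_mx 0 i, 0)) beta.

(* D_t^j D_x^beta u on the closed cylinder: the classical derivative in the open
   cylinder, extended by its limits. *)
Definition Dtx (j : nat) beta u : 'rV[R]_N * R -> R :=
  fun z => lim (dderiv (par_dirs j beta) u w @[w --> within cyl (nbhs z)]).

(* u is continuous on the closed cylinder, and its derivatives of parabolic order
   at most m exist and are continuous in the open cylinder, with continuous
   extensions to the closed one. *)
Definition C_par (m : nat) u : Prop :=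
  (forall z, ccyl z -> u w @[w --> within cyl (nbhs z)] --> u z) /\
  forall j beta, (par_order j beta <= m)%N ->
    [/\ dderivable cyl (par_dirs j beta) u,
        forall z, cyl z -> {for z, continuous (dderiv (par_dirs j beta) u)} &
        forall z, ccyl z ->
          cvg (dderiv (par_dirs j beta) u w @[w --> within cyl (nbhs z)])].

Local Open Scope ereal_scope.

Definition sup_cyl w : \bar R := ereal_sup [set `|w z|%:E | z in ccyl].

Definition hoelder_x (gamma : R) w : \bar R :=
  ereal_sup [set (`|w (z.1.1, z.2) - w (z.1.2, z.2)|
                  / enorm (z.1.1 - z.1.2) `^ gamma)%:E
    | z in [set z : 'rV[R]_N * 'rV[R]_N * R |
            [/\ ccyl (z.1.1, z.2), ccyl (z.1.2, z.2) & z.1.1 != z.1.2]]].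

Definition hoelder_t (gamma : R) w : \bar R :=
  ereal_sup [set (`|w (z.1, z.2.1) - w (z.1, z.2.2)|
                  / `|z.2.1 - z.2.2| `^ gamma)%:E
    | z in [set z : 'rV[R]_N * (R * R) |
            [/\ ccyl (z.1, z.2.1), ccyl (z.1, z.2.2) & z.2.1 != z.2.2]]].

Definition par_norm_int (m : nat) u : \bar R :=
  \sum_(beta : multiindex N m)
    \sum_(j < m.+1 | (par_order j (entries beta) <= m)%N)
      sup_cyl (Dtx j (entries beta) u).

Definition par_hoelder_x (m : nat) (al : R) u : \bar R :=
  \sum_(beta : multiindex N m)
    \sum_(j < m.+1 |
          (par_order j (entries beta) <= m <= (par_order j (entries beta)).+1)%N)
      hoelder_x al (Dtx j (entries beta) u).

Definition par_hoelder_t (m : nat) (al : R) u : \bar R :=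
  \sum_(beta : multiindex N m)
    \sum_(j < m.+1 |
          (par_order j (entries beta) <= m <= (par_order j (entries beta)).+1)%N)
      hoelder_t (((m - par_order j (entries beta))%:R + al) / 2)%R
        (Dtx j (entries beta) u).

(* |u|^{(l)} *)
Definition par_norm (l : R) u : \bar R :=
  let m := Num.truncn l in
  if l \is a Num.int then par_norm_int m u
  else par_norm_int m u + par_hoelder_x m (l - m%:R)%R u
                        + par_hoelder_t m (l - m%:R)%R u.

(* The space C^{l,l/2} on the closed cylinder, for a noninteger l. *)
Definition C_par_hoelder (l : R) u : Prop :=
  C_par (Num.truncn l) u /\ par_norm l u < +oo.

Definition row_of_tuple (x : N.-tuple (measurableTypeR R)) : 'rV[R]_N :=
  \row_i tnth x i.

Definition cyl_fun u : N.-tuple (measurableTypeR R) * measurableTypeR R -> R :=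
  (fun z => u (row_of_tuple z.1, z.2)) \_
  [set z | cyl (row_of_tuple z.1, z.2)].

Definition slice_fun u (t : R) : N.-tuple (measurableTypeR R) -> R :=
  (fun x => u (row_of_tuple x, t)) \_ [set x | Omega (row_of_tuple x)].

Definition in_Lp (p : R) u : Prop :=
  cyl_fun u \in Lfun (leb N \x @lebesgue_measure R) p%:E.

Definition Lp_norm (p : R) u : \bar R :=
  'N[leb N \x @lebesgue_measure R]_p%:E[EFin \o cyl_fun u].

Definition sup_Lp_norm (p : R) u : \bar R :=
  ereal_sup [set 'N[leb N]_p%:E[EFin \o slice_fun u t] | t in `]0%R, T[%classic].

End parabolic.

(* Main.v *)
Require Import Defs.
From HB Require Import structures.
From mathcomp Require Import all_boot all_order all_algebra.
From mathcomp Require Import all_classical all_reals all_analysis.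
From mathcomp Require Import measurable_realfun.
From mathcomp Require Import zify ring lra.
Set Implicit Arguments.
Unset Strict Implicit.
Unset Printing Implicit Defensive.
Import Order.TTheory GRing.Theory Num.Theory.
Import numFieldNormedType.Exports.
Local Open Scope classical_set_scope.
Local Open Scope ring_scope.

(* Fix a small length scale h.  If D^k u stands for the derivatives of parabolic
   order k, the quantities a_k = h^k sup |D^k u| satisfy, for theta <= 1,
     a_k <= C theta^-2 (a_0 + .. + a_(k-1)) + C theta^al (a_(k+1) + .. + h^l2 |u|^(l2)),
   because D^k u is a difference quotient of a derivative of lower order, up to
   the oscillation of D^k u.  All a_k are thus bounded by a_0 + h^l2 |u|^(l2).
   Next, |u| at a point exceeds its values on a box of size theta h by at most
   theta^al (a_1 + a_2), and the infimum of |u| on that box is at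
   most C (theta h)^-d ||u||_p, with d = (N + 2) / p for boxes in space-time and
   d = N / p for boxes in space; for small theta, a_0 is absorbed and
     |u|^(l1) <= C h^-l1 (h^l2 |u|^(l2) + h^-d ||u||_p),
   whence the theorem for the best h.  The boundary only enters through a uniform
   cone condition, which provides boxes near every point and short paths between
   close points. *)

(** * Directional derivatives *)

Section directional.
Context {R : realType} {V : normedModType R}.
Implicit Types (f : V -> R) (a b v x : V) (U : set V).

(** [C_par] provides derivatives in one order only, D_t outermost and the space directions sorted,
    whereas the argument differentiates any D^k u along any x_i. This calls for the symmetry of
    derivatives in a form that also yields the existence of the permuted ones. The inequality for
    a_k involves the orders k + 1 and k + 2 on its right side, so it cannot be used from one order
    to the next alone; the chain closes because their factor can be made as small as desired before
    the constant of the lower orders is fixed. Constants must not depend on u or h, so the chain of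
    inequalities is solved for a whole family of sequences at once. The step is theta h in space and
    (theta h)^2 in time, matching the parabolic order. The scale h is bounded by the geometry; when
    the best h would be larger, the L_p norm is so large compared with |u|^(l2) that the largest
    admissible h is good enough. Estimates are proved in the open cylinder and reach the closed one
    by limits, as [Dtx] is itself a limit. *)

Lemma line_is_derive f x v (s : R) : derivable f (s *: v + x) v ->
  is_derive s (1 : R) (fun s => f (s *: v + x)) ('D_v f (s *: v + x)).
Proof.
have E : (fun h : R => h^-1 *: (((fun s => f (s *: v + x)) \o shift s) (h *: (1:R)) -
      f (s *: v + x)))
   = (fun h : R => h^-1 *: ((f \o shift (s *: v + x)) (h *: v) - f (s *: v + x))).
  apply/funext => h /=; congr (_ *: (f _ - _)).
  by rewrite -[(h *: 1)]/(h * 1) mulr1 scalerDl addrA.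
by move=> df; apply: DeriveDef; rewrite ?/derivable ?/derive E.
Qed.

Lemma translate_is_derive f c x v : derivable f (c + x) v ->
  is_derive x v (fun z => f (c + z)) ('D_v f (c + x)).
Proof.
have E : (fun h : R => h^-1 *: (((fun z => f (c + z)) \o shift x) (h *: v) - f (c + x)))
   = (fun h : R => h^-1 *: ((f \o shift (c + x)) (h *: v) - f (c + x))).
  by apply/funext => h /=; congr (_ *: (f _ - _)); rewrite addrCA.
by move=> df; apply: DeriveDef; rewrite ?/derivable ?/derive E.
Qed.

(** The two conditions on s place it between 0 and r whatever the sign of r. Both signs occur later:
    a time step goes forward or backward depending on where the cylinder leaves room. *)
Lemma mvt_dir f x v (r : R) :
  (forall s, 0 <= s * r -> `|s| <= `|r| -> derivable f (s *: v + x) v) ->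
  exists s, [/\ 0 <= s * r, `|s| <= `|r| &
    f (r *: v + x) - f x = r * 'D_v f (s *: v + x)].
Proof.
move=> df.
have dfl s : 0 <= s * r /\ `|s| <= `|r| ->
    is_derive s (1 : R) (fun s => f (s *: v + x)) ('D_v f (s *: v + x)).
  by case=> sr0 sr; apply: line_is_derive; exact: df.
have [r0|/ltW r0] := leP 0 r.
  have sE s : 0 <= s <= r -> 0 <= s * r /\ `|s| <= `|r|.
    by case/andP=> s0 sr; rewrite mulr_ge0// !ger0_norm.
  have [||s] := @MVT_segment R (fun s => f (s *: v + x))
      (fun s => 'D_v f (s *: v + x)) 0 r r0.
  - by move=> s; rewrite in_itv /= => /andP[s0 sr]; apply/dfl/sE; rewrite !ltW.
  - apply: derivable_within_continuous => s; rewrite in_itv /= => /sE sr.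
    by case: (dfl s sr).
  rewrite in_itv /= => /sE[sr0 sr]; rewrite scale0r add0r subr0 => ->.
  by exists s; split=> //; rewrite mulrC.
have sE s : r <= s <= 0 -> 0 <= s * r /\ `|s| <= `|r|.
  by case/andP=> s0 sr; rewrite mulr_le0// !ler0_norm// lerN2.
have [||s] := @MVT_segment R (fun s => f (s *: v + x))
    (fun s => 'D_v f (s *: v + x)) r 0 r0.
- by move=> s; rewrite in_itv /= => /andP[s0 sr]; apply/dfl/sE; rewrite !ltW.
- apply: derivable_within_continuous => s; rewrite in_itv /= => /sE sr.
  by case: (dfl s sr).
rewrite in_itv /= => /sE[sr0 sr]; rewrite scale0r add0r sub0r => E.
by exists s; split=> //; rewrite -opprB E mulrN opprK mulrC.
Qed.

Lemma mvt_dir_le f x v (r S : R) :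
  (forall s, 0 <= s * r -> `|s| <= `|r| -> derivable f (s *: v + x) v) ->
  (forall s, 0 <= s * r -> `|s| <= `|r| -> `|'D_v f (s *: v + x)| <= S) ->
  `|f (r *: v + x) - f x| <= `|r| * S.
Proof.
by move=> /mvt_dir[s [s0 sr ->]] Sf; rewrite normrM ler_wpM2l// Sf.
Qed.

Lemma near_shift2 U x a b : open U -> U x ->
  exists2 d : R, 0 < d &
    forall r s, `|r| < d -> `|s| < d -> U (s *: a + (r *: b + x)).
Proof.
move=> oU Ux.
have /nbhs_ballP[e /= e0 eU] : nbhs x U by exact: open_nbhs_nbhs.
exists (e / (1 + `|a| + `|b|)); first by rewrite divr_gt0// -addrA ltr_wpDr// addr_ge0.
have K0 : 0 < 1 + `|a| + `|b| by rewrite -addrA ltr_wpDr// addr_ge0.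
move=> r s; rewrite !ltr_pdivlMr// => re se; apply: eU.
rewrite -ball_normE /ball_/= addrA opprD addrCA subrr addr0 normrN.
apply: le_lt_trans (ler_normD _ _) _; rewrite !normrZ.
have [rs|sr] := leP `|r| `|s|.
  apply: le_lt_trans se.
  by have := ler_wpM2r (normr_ge0 b) rs; have := normr_ge0 s; lra.
apply: le_lt_trans re.
by have := ler_wpM2r (normr_ge0 a) (ltW sr); have := normr_ge0 r; lra.
Qed.

(* Peano's form of the symmetry of second derivatives: the existence of
   D_b (D_a f) is part of the conclusion. *)
Lemma schwarz f U x a b : open U -> U x ->
  (forall z, U z -> derivable f z a) ->
  (forall z, U z -> derivable f z b) ->
  (forall z, U z -> derivable ('D_b f) z a) ->
  {for x, continuous ('D_a ('D_b f))} ->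
  derivable ('D_a f) x b /\ 'D_b ('D_a f) x = 'D_a ('D_b f) x.
Proof.
move=> oU Ux da db dab cab.
set L := 'D_a ('D_b f) x.
suff H : (fun h : R => h^-1 *: (('D_a f \o shift x) (h *: b) - 'D_a f x)) @ 0^' --> L.
  by split; [apply/cvg_ex; exists L|apply: cvg_lim].
have [d d0 dU] := near_shift2 a b oU Ux.
apply/cvgrPdist_le => /= e e0.
have /cvgrPdist_lt/(_ e e0) Ne := cab.
have [W [[oW Wx] WL]] : exists W : set V, open_nbhs x W /\
    W `<=` [set y | `|L - 'D_a ('D_b f) y| < e].
  by move: Ne; rewrite nbhsE /= => -[B B1 B2]; exists B.
have [d' d'0 dW] := near_shift2 a b oW Wx.
have m0 : 0 < Num.min d d' by rewrite lt_min d0 d'0.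
(* The second mixed difference. The mean value theorem along b and then along a makes it h s times a
   value of D_a (D_b f) near x. *)
pose D2 h s := (f (s *: a + (h *: b + x)) - f (h *: b + x)) - (f (s *: a + x) - f x).
have bound h s : `|h| < Num.min d d' -> `|s| < Num.min d d' ->
   `|h * s * L - D2 h s| <= `|h| * `|s| * e.
  rewrite !lt_min => /andP[hd hd'] /andP[sd sd'].
  have U1 r : `|r| <= `|h| -> U (r *: b + x).
    move=> rh; have := dU r 0 (le_lt_trans rh hd).
    by rewrite normr0 scale0r add0r; apply.
  have U2 r s' : `|r| <= `|h| -> `|s'| <= `|s| -> U (s' *: a + (r *: b + x)).
    by move=> rh ss; apply: dU; [apply: le_lt_trans hd|apply: le_lt_trans sd].
  have dF r : `|r| <= `|h| -> is_derive (r *: b + x) b (fun z => f (s *: a + z) - f z)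
      ('D_b f (s *: a + (r *: b + x)) - 'D_b f (r *: b + x)).
    move=> rh.
    have := translate_is_derive (db _ (U2 r s rh (lexx _))).
    have /derivableP := db _ (U1 _ rh).
    by move=> A B; apply: is_deriveB.
  have [|r [_ rh E1]] := @mvt_dir (fun z => f (s *: a + z) - f z) x b h.
    by move=> r _ rh; case: (dF r rh).
  have [|s' [_ ss E2]] := @mvt_dir ('D_b f) (r *: b + x) a s.
    by move=> s' _ ss; apply/dab/U2.
  rewrite /D2 E1; have /@derive_val -> := dF r rh.
  rewrite E2 mulrA -mulrBr !normrM ler_wpM2l// ?mulr_ge0//.
  apply/ltW/WL; apply: dW; first exact: le_lt_trans hd'.
  exact: le_lt_trans sd'.
near=> h.
have h0 : h != 0 by near: h; exact: nbhs_dnbhs_neq.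
have hd : `|h| < Num.min d d' by near: h; apply: dnbhs0_lt.
have Uh : U (h *: b + x).
  have := dU h 0; rewrite normr0 scale0r add0r; apply => //.
  by move: hd; rewrite lt_min => /andP[].
suff : `|h * L - ('D_a f (h *: b + x) - 'D_a f x)| <= `|h| * e.
  move=> H /=; rewrite -(ler_pM2l (_ : 0 < `|h|)) ?normr_gt0// -normrM mulrBr.
  by rewrite -[h^-1 *: _]/(h^-1 * _) mulrA divff// mul1r.
(* With h fixed, s tends to 0 first: the quotient of [D2 h s] by s becomes an increment of D_a f,
   and the bound, uniform in s, survives the limit. *)
have C : (fun s => h * L - s^-1 *: D2 h s) @ 0^' -->
    h * L - ('D_a f (h *: b + x) - 'D_a f x).
  apply: cvgB; first exact: cvg_cst.
  have -> : (fun s => s^-1 *: D2 h s) = (fun s : R =>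
      s^-1 *: ((f \o shift (h *: b + x)) (s *: a) - f (h *: b + x))
      - s^-1 *: ((f \o shift x) (s *: a) - f x)).
    by apply/funext => s; rewrite -scalerBr.
  by apply: cvgB; [apply: da|apply: da].
apply: (cvgr_to_le (cvg_norm C)).
near=> s.
have s0 : s != 0 by near: s; exact: nbhs_dnbhs_neq.
have sd : `|s| < Num.min d d' by near: s; apply: dnbhs0_lt.
rewrite -(ler_pM2l (_ : 0 < `|s|)) ?normr_gt0// -normrM mulrBr.
rewrite -[s^-1 *: _]/(s^-1 * _) [X in _ - X]mulrA divff// mul1r.
by rewrite mulrA [s * h]mulrC mulrA [`|s| * _]mulrC bound.
Unshelve. all: by end_near. Qed.

End directional.

(** * Lipschitz estimates and boxes *)

Section row_norm.
Context {R : realType} {n : nat}.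
Implicit Types (x y z : 'rV[R]_n) (r : R).

Lemma rV_norm_leP x r : 0 <= r -> (`|x| <= r) <-> (forall i, `|x 0 i| <= r).
Proof.
move=> r0; rewrite -[`|x|]/(mx_norm x) mx_normrE; split.
  move=> /bigmax_leP[_ H] i; exact: (H (0, i)).
by move=> H; apply/bigmax_leP; split=> // -[i j] _ /=; rewrite ord1.
Qed.

Lemma rV_norm_ge x i : `|x 0 i| <= `|x|.
Proof. by move: i; apply/rV_norm_leP. Qed.

Lemma norm_delta_mx i : `|delta_mx 0 i : 'rV[R]_n| <= 1.
Proof.
apply/rV_norm_leP => // j; rewrite mxE eqxx /=.
by case: eqP; rewrite ?normr1 ?normr0.
Qed.

Lemma enorm_ge0 x : 0 <= enorm x. Proof. exact: sqrtr_ge0. Qed.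

Lemma norm_le_enorm x : `|x| <= enorm x.
Proof.
apply/rV_norm_leP; first exact: enorm_ge0.
move=> i; rewrite -sqrtr_sqr ler_wsqrtr// (bigD1 i)//= lerDl.
by apply: sumr_ge0 => j _; exact: sqr_ge0.
Qed.

Lemma enorm_le x : enorm x <= n%:R * `|x|.
Proof.
rewrite -[leRHS]ger0_norm ?mulr_ge0// -sqrtr_sqr ler_wsqrtr//.
apply: (@le_trans _ _ (\sum_(i < n) `|x| ^+ 2)).
  apply: ler_sum => i _; rewrite -[leLHS]real_normK ?num_real//.
  by rewrite lerXn2r ?nnegrE// rV_norm_ge.
rewrite sumr_const card_ord exprMn -[leLHS]mulr_natl ler_wpM2r ?sqr_ge0//.
by rewrite -natrX ler_nat; case: n => // k; rewrite leq_pmulr.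
Qed.

Lemma enorm_lt x r : n%:R * `|x| < r -> enorm x < r.
Proof. exact/le_lt_trans/enorm_le. Qed.

(** A ball of the maximum norm is a box, so the path from a to b that changes one coordinate at a
    time stays inside. Each of its n legs uses a single partial derivative, and total
    differentiability is never called for. *)
Lemma box_lip (f : 'rV[R]_n -> R) c a b r (S : R) :
  (forall y, `|y - c| <= r -> forall i, derivable f y (delta_mx 0 i) /\
    `|'D_(delta_mx 0 i) f y| <= S) ->
  `|a - c| <= r -> `|b - c| <= r -> `|f b - f a| <= n%:R * `|b - a| * S.
Proof.
move=> df ac bc.
have r0 : 0 <= r by exact: le_trans (normr_ge0 _) ac.
pose p k : 'rV[R]_n := \row_i (if (i < k)%N then b 0 i else a 0 i).
have p0 : p 0%N = a by apply/rowP => i; rewrite mxE.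
have pn : p n = b by apply/rowP => i; rewrite mxE ltn_ord.
have step (k : 'I_n) : `|f (p k.+1) - f (p k)| <= `|b - a| * S.
  have pS : p k.+1 = (b 0 k - a 0 k) *: delta_mx 0 k + p k.
    apply/rowP => i; rewrite !mxE eqxx /= ltnS.
    have [<-|ki] := eqVneq k i; first by rewrite leqnn ltnn mulr1 subrK.
    by rewrite mulr0 add0r leq_eqVlt -[nat_of_ord i == _]/(i == k) eq_sym (negbTE ki).
  have inb s : 0 <= s * (b 0 k - a 0 k) -> `|s| <= `|b 0 k - a 0 k| ->
      `|s *: delta_mx 0 k + p k - c| <= r.
    move=> s0 sr; apply/rV_norm_leP => // i; rewrite !mxE eqxx /=.
    have := le_trans (rV_norm_ge _ i) ac; have := le_trans (rV_norm_ge _ i) bc.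
    rewrite !mxE; have [ki|ki] := eqVneq i k; last first.
      by rewrite mulr0 add0r; case: ifP.
    rewrite ki ltnn mulr1 !ler_norml => /andP[b1 b2] /andP[a1 a2].
    move: s0 sr; have [d0|d0] := leP 0 (b 0 k - a 0 k).
      have [s1|s1] := leP 0 s; first by rewrite !ger0_norm//; lra.
      rewrite (ltr0_norm s1) (ger0_norm d0) => sd0.
      have [->|dn0] := eqVneq (b 0 k - a 0 k) 0; first lra.
      by move: sd0; rewrite leNgt nmulr_rlt0// lt_def dn0 d0.
    rewrite (ltr0_norm d0); have [s1|s1] := leP s 0.
      by rewrite (ler0_norm s1); lra.
    by rewrite leNgt pmulr_rlt0// d0.
  have S0 : 0 <= S.
    have := proj2 (df a ac k); exact: le_trans.
  rewrite pS; apply: le_trans (_ : `|b 0 k - a 0 k| * S <= _); last first.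
    by rewrite ler_wpM2r//; have := rV_norm_ge (b - a) k; rewrite !mxE.
  by apply: mvt_dir_le => s s0 sr; case: (df _ (inb _ s0 sr) k).
rewrite -{1}pn -{1}p0.
have -> : f (p n) - f (p 0%N) = \sum_(k < n) (f (p k.+1) - f (p k)).
  by rewrite -(big_mkord xpredT (fun k => f (p k.+1) - f (p k))) telescope_sumr.
apply: le_trans (ler_norm_sum _ _ _) _.
apply: le_trans (ler_sum _ (fun k _ => step k)) _.
by rewrite sumr_const card_ord -mulrA mulr_natl.
Qed.

(* A segment whose [d]-neighbourhood lies in [U] is cut into short pieces,
   each inside a box. *)
Lemma segment_lip (f : 'rV[R]_n -> R) (U : set 'rV[R]_n) x v (d S : R) :
  0 < d ->
  (forall s y, 0 <= s <= 1 -> `|y| < d -> U (x + s *: v + y)) ->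
  (forall y, U y -> forall i, derivable f y (delta_mx 0 i) /\
    `|'D_(delta_mx 0 i) f y| <= S) ->
  `|f (x + v) - f x| <= n%:R * `|v| * S.
Proof.
move=> d0 xU df.
(* Enough pieces for each to have length at most d / 2: the closed box of that radius lies in the
   open d-neighbourhood. *)
pose k := (Num.truncn (`|v| / (d / 2))).+1.
have k0 : 0 < k%:R :> R by rewrite ltr0n.
have vk : `|v| / k%:R <= d / 2.
  rewrite ler_pdivrMr// -ler_pdivrMl ?divr_gt0// mulrC.
  by apply: ltW; rewrite /k truncnS_gt.
pose p (j : nat) := x + (j%:R / k%:R) *: v.
have p0 : p 0%N = x by rewrite /p mul0r scale0r addr0.
have pk : p k = x + v by rewrite /p divff ?gt_eqF// scale1r.
have step (j : 'I_k) : `|f (p j.+1) - f (p j)| <= n%:R * (`|v| / k%:R) * S.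
  have pS : p j.+1 - p j = k%:R^-1 *: v.
    rewrite /p [j.+1%:R]mulrS mulrDl scalerDl mul1r.
    by rewrite opprD addrACA subrr add0r addrK.
  have -> : `|v| / k%:R = `|p j.+1 - p j|.
    by rewrite pS normrZ normfV (ger0_norm (ltW k0)) mulrC.
  have jk : 0 <= (j%:R : R) / k%:R <= 1.
    by rewrite divr_ge0//= ler_pdivrMr// mul1r ler_nat ltnW.
  apply: (@box_lip f (p j) _ _ (d / 2)).
  - move=> y yp; apply: df; rewrite -(subrK (p j) y) addrC; apply: xU => //.
    by apply: le_lt_trans yp _; rewrite ltr_pdivrMr// ltr_pMr// ltr1n.
  - by rewrite subrr normr0 divr_ge0// ltW.
  - by rewrite pS normrZ normfV (ger0_norm (ltW k0)) mulrC.
rewrite -pk -p0.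
have -> : f (p k) - f (p 0%N) = \sum_(j < k) (f (p j.+1) - f (p j)).
  by rewrite -(big_mkord xpredT (fun j => f (p j.+1) - f (p j))) telescope_sumr.
apply: le_trans (ler_norm_sum _ _ _) _.
apply: le_trans (ler_sum _ (fun k _ => step k)) _.
rewrite sumr_const card_ord -[leLHS]mulr_natr le_eqVlt; apply/orP; left; apply/eqP.
by field; rewrite gt_eqF.
Qed.

(** Otherwise the part of the segment from x to z that lies in U would be nonempty, open and closed
    in the segment, hence all of it. *)
Lemma boundary_between (U : set 'rV[R]_n) x z : open U -> U x -> ~ U z ->
  exists2 y, (closure U `\` interior U) y & `|y - x| <= `|z - x|.
Proof.
move=> oU Ux Uz; apply: contrapT => H.
pose g (s : R) : 'rV[R]_n := x + s *: (z - x).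
have cg : continuous g.
  move=> s; apply: cvgD; [exact: cvg_cst|].
  by apply: cvgZr_tmp; [exact: cvg_id].
have gU s : 0 <= s <= 1 -> closure U (g s) -> U (g s).
  move=> s01 cU; apply: contrapT => nU; apply: H; exists (g s).
    by split=> //; move/interior_subset.
  rewrite /g addrC addKr normrZ ger0_norm; last by case/andP: s01.
  by rewrite ler_piMl//; case/andP: s01.
suff : `[0, 1]%classic `&` g @^-1` U = `[0, 1]%classic.
  move=> /seteqP[_ /(_ 1)] /=; rewrite in_itv /= ler01 lexx => /(_ isT)[_].
  by rewrite /g scale1r addrC subrK.
apply: segment_connected.
- by exists 0; split=> /=; rewrite ?in_itv/= ?lexx ?ler01// /g scale0r addr0.
- exists (g @^-1` U) => //; apply: open_comp => //.
- exists (g @^-1` closure U).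
    by apply: closed_comp => //; exact: closed_closure.
  apply/seteqP; split=> s /= [s01 Us]; split=> //; first exact: subset_closure.
  by apply: gU => //; move: s01; rewrite in_itv.
Qed.

End row_norm.

(** * Sorted multiindices *)

Section sorted_indices.
Variable n : nat.
Implicit Types (s : seq 'I_n) (i : 'I_n) (beta : 'I_n -> nat).

Definition ole : rel 'I_n := fun i j => (i <= j)%N.

Lemma ole_trans : transitive ole. Proof. by move=> j i k; exact: leq_trans. Qed.
Lemma ole_anti : antisymmetric ole.
Proof. by move=> i j /anti_leq/val_inj. Qed.

(** Sorted sequences stand for multiindices: adding or removing one direction becomes a list
    operation, and the sorted order is the one in which [multi_dirs] differentiates. *)
Definition idx_seq beta : seq 'I_n :=
  flatten [seq nseq (beta i) i | i <- enum 'I_n].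

Lemma multi_dirs_idx (V : Type) (e : 'I_n -> V) beta :
  multi_dirs e beta = map e (idx_seq beta).
Proof.
rewrite /multi_dirs /idx_seq map_flatten -map_comp; congr flatten.
by apply: eq_map => i /=; rewrite map_nseq.
Qed.

Lemma count_idx_seq beta i : count_mem i (idx_seq beta) = beta i.
Proof.
rewrite count_flatten -map_comp sumnE big_map big_enum /= (bigD1 i)//=.
rewrite count_nseq /= eqxx mul1n big1 ?addn0// => j ji.
by rewrite count_nseq /= (negbTE ji).
Qed.

Lemma size_idx_seq beta : size (idx_seq beta) = msize beta.
Proof.
rewrite size_flatten /shape -map_comp sumnE big_map big_enum /=.
by apply: eq_bigr => i _ /=; rewrite size_nseq.
Qed.

Lemma sorted_idx_seq beta : sorted ole (idx_seq beta).
Proof.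
rewrite sorted_pairwise; last exact: ole_trans.
have : pairwise (fun i j : 'I_n => (i < j)%N) (enum 'I_n).
  have := iota_ltn_sorted 0 n; rewrite -val_enum_ord sorted_pairwise; last exact: ltn_trans.
  by rewrite pairwise_map.
rewrite /idx_seq; elim: (enum 'I_n) => //= x e IH /andP[xe pe].
rewrite pairwise_cat IH// andbT; apply/andP; split.
  apply/allrelP => a b /nseqP[-> _] /flattenP[t] /mapP[y ye ->] /nseqP[-> _].
  by move/allP : xe => /(_ _ ye); exact: ltnW.
by elim: (beta x) => //= k ->; rewrite andbT all_nseq /ole leqnn orbT.
Qed.

Lemma idx_seq_count s : sorted ole s -> idx_seq (fun i => count_mem i s) = s.
Proof.
move=> ss; apply: (sorted_eq ole_trans ole_anti (sorted_idx_seq _) ss).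
by apply/allP => i _ /=; rewrite count_idx_seq.
Qed.

Lemma msize_count s : msize (fun i => count_mem i s) = size s.
Proof.
rewrite -size_idx_seq size_flatten /shape -map_comp sumnE big_map big_enum /=.
under eq_bigr do rewrite size_nseq.
elim: s => [|x s IH] /=; first by rewrite big1.
by rewrite big_split /= IH (bigD1 x)//= eqxx big1 ?addn0// => i /negbTE; rewrite eq_sym => ->.
Qed.

Lemma entries_count m s : (size s <= m)%N ->
  exists beta : multiindex n m, entries beta = (fun i => count_mem i s).
Proof.
move=> sm; exists [ffun i => inord (count_mem i s)]; apply/funext => i.
rewrite /entries ffunE inordK// ltnS; apply: leq_trans sm; exact: count_size.
Qed.

End sorted_indices.

Lemma le_bigsum_ge0 {R : realType} (I : finType) (P : pred I) (F : I -> \bar R) i :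
  P i -> (forall j, P j -> 0 <= F j)%E -> (F i <= \sum_(j | P j) F j)%E.
Proof.
move=> Pi F0; rewrite (bigD1 i)//= leeDl// sume_ge0// => j /andP[Pj _]; exact: F0.
Qed.

Section chart_gradient.
Context {R : realType} {n : nat}.
Implicit Type h : 'rV[R]_n -> R.

Lemma C_bounded1_gradient (D : set 'rV[R]_n) (K : R) h : D !=set0 ->
  C_bounded D 1 K h -> forall y, D y -> forall i,
  derivable h y (delta_mx 0 i) /\ `|'D_(delta_mx 0 i) h y| <= K.
Proof.
move=> [y0 Dy0]; rewrite /C_bounded /hnorm truncn1 => -[CD].
rewrite rpred1 adde0 => hK y Dy i.
pose b := fun j => count_mem j [:: i].
have bE : multi_dirs (fun i => delta_mx 0 i : 'rV[R]_n) b = [:: delta_mx 0 i].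
  by rewrite multi_dirs_idx idx_seq_count.
have b1 : (msize b <= 1)%N by rewrite msize_count.
split.
  by have [+ _] := CD b b1; rewrite bE /= => -[_]; apply.
have [beta bb] := @entries_count n 1 [:: i] isT.
rewrite -lee_fin; apply: le_trans hK.
apply: le_trans (@le_bigsum_ge0 _ _ _ _ beta _ _); last 2 first.
- by rewrite bb.
- move=> b' _; apply: le_trans (ereal_sup_ubound _); last by exists y0; [|reflexivity].
  by rewrite lee_fin.
apply: ereal_sup_ubound; exists y => //; rewrite /= /Dx bb.
by rewrite -/b bE.
Qed.
End chart_gradient.

(** * The cone condition *)

Section cone_condition.
Context {R : realType} {N : nat}.
Implicit Types (Q : 'M[R]_N) (x v : 'rV[R]_N).

Lemma orthogonal_entry_le1 Q i j : Q *m Q^T = 1%:M -> `|Q i j| <= 1.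
Proof.
move=> QQ; have := congr1 (fun M : 'M[R]_N => M i i) QQ.
rewrite !mxE eqxx /= (bigD1 j)//= mxE -expr2 => E.
rewrite -(@expr_le1 _ 2)// real_normK ?num_real//.
rewrite -[leRHS]E lerDl sumr_ge0// => k _.
by rewrite mxE -expr2 sqr_ge0.
Qed.

Lemma norm_mul_orthogonal Q v : Q *m Q^T = 1%:M -> `|v *m Q^T| <= N%:R * `|v|.
Proof.
move=> QQ; apply/rV_norm_leP; first by rewrite mulr_ge0.
move=> i; rewrite !mxE; apply: le_trans (ler_norm_sum _ _ _) _.
apply: (@le_trans _ _ (\sum_(j < N) `|v|)); last by rewrite sumr_const card_ord mulr_natl.
apply: ler_sum => j _; rewrite normrM -[leRHS]mulr1 ler_pM ?rV_norm_ge//.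
by rewrite mxE orthogonal_entry_le1.
Qed.

(* [e = 0] is allowed, and is chosen far from the boundary. *)
Definition cone_condition (Omega : set 'rV[R]_N) (r0 c : R) :=
  forall x, Omega x -> exists2 e : 'rV[R]_N, `|e| <= 1 &
    forall y s z, Omega y -> `|y - x| <= r0 -> 0 < s <= r0 -> `|z| <= c * s ->
      Omega (y + s *: e + z).

(** In a chart the domain lies above a Lipschitz graph, so moving up by s leaves room proportional
    to s in all directions. The uniformity of the charts makes [r0] and [c] the same for all
    points. *)
Lemma smooth_boundary_cone (l : R) (Omega : set 'rV[R]_N) : (0 < N)%N ->
  open Omega -> smooth_boundary l Omega ->
  exists r0 c : R, [/\ 0 < r0, 0 < c, c <= 1 & cone_condition Omega r0 c].
Proof.
move=> N0 oO [rho [K [rho0 chart]]].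
have N1 : 1 <= N%:R :> R by rewrite ler1n.
have N1' : 0 < N%:R :> R by rewrite ltr0n.
(* A Lipschitz constant of the graph functions for the maximum norm, by [box_lip]. *)
pose L : R := N%:R * `|K|.
have L0 : 0 <= L by rewrite mulr_ge0.
(* The Euclidean norm is at most N times the maximum norm, so boxes of radius [r1] fit in the ball
   of radius rho. *)
pose r1 : R := rho / (2 * N%:R).
have r10 : 0 < r1 by rewrite divr_gt0// mulr_gt0.
(* If a boundary point x0 is within 3 r0 of x, a point y within r0 of x is within 4 r0 of x0. The
   rotation costs a factor N, and the displacement adds at most s + N r0, hence at most 2 N r0; the
   total 6 N r0 is [r1]. *)
pose r0 := r1 / (6 * N%:R).
have r00 : 0 < r0 by rewrite divr_gt0// mulr_gt0.
have r0r1 : 6 * N%:R * r0 = r1 by rewrite /r0; field; rewrite gt_eqF.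
(* In chart coordinates a perturbation has size at most N c s. It raises the graph by at most L N c
   s and lowers the point by at most N c s, together less than the gain s. *)
pose c := (N%:R * (L + 2))^-1.
have c0 : 0 < c by rewrite invr_gt0 mulr_gt0// ltr_wpDl.
have cE : N%:R * c * (L + 2) = 1 by rewrite /c; field; rewrite !gt_eqF// ltr_wpDl.
have c1 : c <= 1.
  rewrite invf_le1 ?mulr_gt0 ?ltr_wpDl//.
  by rewrite -[leLHS]mulr1 ler_pM//; lra.
exists r0, c; split=> // x Ox.
have [near|] := pselect (forall z, `|z - x| <= 3 * r0 -> Omega z).
  exists 0; rewrite ?normr0// => y s z Oy yx /andP[s0 sr] zc; apply: near.
  rewrite scaler0 addr0 addrAC; apply: le_trans (ler_normD _ _) _.
  have : c * s <= 1 * r0 by rewrite ler_pM// ltW.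
  by move: zc yx; lra.
move=> /existsNP[z /not_implyP[zx Oz]].
have [x0 bx0 x0x] := boundary_between oO Ox Oz.
have {x0x z zx Oz} x0r := le_trans x0x zx.
have [Q [k [h [QQ hC1 _ graph]]]] := chart _ bx0.
have QQ' : Q^T *m Q = 1%:M by rewrite mulmx1C.
have inE (y : 'rV[R]_N) : `|y| <= r1 -> eball rho y.
  move=> yr; apply: enorm_lt; apply: (@le_lt_trans _ _ (N%:R * r1)).
    by rewrite ler_wpM2l.
  have -> : N%:R * r1 = rho / 2 by rewrite /r1; field; rewrite gt_eqF.
  by lra.
have Nle : N.-1%:R <= N%:R :> R by rewrite ler_nat leq_pred.
have inE' (y : 'rV[R]_N.-1) : `|y| <= r1 -> eball rho y.
  move=> yr; apply: enorm_lt; apply: (@le_lt_trans _ _ (N%:R * r1)).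
    by rewrite ler_pM.
  have -> : N%:R * r1 = rho / 2 by rewrite /r1; field; rewrite gt_eqF.
  by lra.
have hlip (a b : 'rV[R]_N.-1) : `|a| <= r1 -> `|b| <= r1 ->
    `|h b - h a| <= L * `|b - a|.
  move=> ar br.
  have ne : @eball R N.-1 rho !=set0 by exists a; exact: inE'.
  apply: (@le_trans _ _ (N.-1%:R * `|b - a| * `|K|)).
    apply: (@box_lip _ _ h 0 a b r1); rewrite ?subr0//.
    move=> y; rewrite subr0 => yr i.
    have [dh hK] := C_bounded1_gradient ne hC1 (inE' _ yr) i.
    by split=> //; apply: le_trans hK (ler_norm _).
  by rewrite /L mulrAC ler_wpM2r// ler_wpM2r.
have col'_le (y : 'rV[R]_N) : `|col' k y| <= `|y|.
  by apply/rV_norm_leP => // i; rewrite mxE rV_norm_ge.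
(* The vertical direction of the chart in the original coordinates. *)
exists (row k Q).
  by apply/rV_norm_leP => // i; rewrite mxE orthogonal_entry_le1.
move=> y s z Oy yx /andP[s0 sr] zc.
pose eta := (y - x0) *m Q^T.
pose zeta := z *m Q^T.
have yE : y = x0 + eta *m Q by rewrite /eta -mulmxA QQ' mulmx1 addrC subrK.
have -> : y + s *: row k Q + z = x0 + (eta + (s *: delta_mx 0 k + zeta)) *m Q.
  rewrite !mulmxDl -scalemxAl -rowE /zeta -[z *m _ *m _]mulmxA QQ' mulmx1.
  by rewrite [in LHS]yE !addrA.
have etar : `|eta| <= 4 * N%:R * r0.
  apply: le_trans (norm_mul_orthogonal _ QQ) _.
  rewrite -mulrA mulrCA ler_wpM2l//.
  rewrite -(subrK x y) -addrA; apply: le_trans (ler_normD _ _) _.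
  by rewrite [`|x - x0|]distrC; lra.
have zetar : `|zeta| <= N%:R * c * s.
  by apply: le_trans (norm_mul_orthogonal _ QQ) _; rewrite -mulrA ler_wpM2l.
have zetar0 : `|zeta| <= N%:R * r0.
  by apply: le_trans zetar _; rewrite -mulrA ler_wpM2l// -[leRHS]mul1r ler_pM// ltW.
have Nr0 : r0 <= N%:R * r0 by rewrite -[leLHS]mul1r ler_wpM2r// ltW.
have etar1 : `|eta| <= r1.
  by apply: le_trans etar _; have := ltW r00; lra.
clearbody eta zeta; set w := s *: delta_mx 0 k + zeta.
have wr : `|eta + w| <= r1.
  apply: le_trans (ler_normD _ _) _.
  have := ler_normD (s *: delta_mx 0 k) zeta; rewrite -/w => w1.
  have : `|s *: delta_mx 0 k : 'rV[R]_N| <= s.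
    rewrite normrZ (gtr0_norm s0) -[leRHS]mulr1 ler_wpM2l ?norm_delta_mx//.
    exact: ltW.
  by lra.
apply/graph; first exact: inE.
have e1 := inE _ etar1.
have : h (col' k eta) < eta 0 k by apply/graph => //; rewrite -yE.
have colw : col' k (eta + w) - col' k eta = col' k zeta.
  apply/rowP => i; rewrite !mxE eqxx /= (_ : lift k i == k = false) ?mulr0 ?add0r.
    by rewrite addrC addKr.
  by rewrite eq_sym; apply/negbTE; exact: neq_lift.
have hh : `|h (col' k (eta + w)) - h (col' k eta)| <= L * (N%:R * c * s).
  apply: le_trans (hlip _ _ (le_trans (col'_le _) etar1) (le_trans (col'_le _) wr)) _.
  by rewrite colw ler_wpM2l//; apply: le_trans (col'_le _) zetar.
rewrite !mxE !eqxx mulr1.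
have := le_trans (rV_norm_ge zeta k) zetar.
move: hh; rewrite !ler_norml => /andP[_ h2] /andP[z1 _] hlt.
have : 0 < N%:R * c * s by rewrite !mulr_gt0.
have : L * (N%:R * c * s) + 2 * (N%:R * c * s) = s by rewrite -mulrDl mulrC mulrAC cE mul1r.
move: h2 z1 hlt; set M := N%:R * c * s; set LM := L * M.
by clearbody LM M; lra.
Qed.

End cone_condition.

(** * Short paths and boxes inside the domain *)

Section cone_consequences.
Context {R : realType} {N : nat}.
Variables (Omega : set 'rV[R]_N) (r0 c : R).
Hypotheses (r0_gt0 : 0 < r0) (c_gt0 : 0 < c) (c_le1 : c <= 1).
Hypothesis (oOmega : open Omega) (cone : cone_condition Omega r0 c).

(** The segment from x to y may leave the domain. The detour climbs from both points along the cone
    direction of x by s = 2 d / c, with d the distance; at that height the box of radius c s = 2 d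
    about x + s e lies in the domain and contains the other end. Two climbs and one crossing have
    length at most 5 d / c. *)
Lemma cone_lip (f : 'rV[R]_N -> R) (S : R) x y :
  Omega x -> Omega y -> `|y - x| <= c * r0 / 2 ->
  (forall y, Omega y -> forall i, derivable f y (delta_mx 0 i) /\
    `|'D_(delta_mx 0 i) f y| <= S) ->
  `|f y - f x| <= 5 * N%:R / c * `|y - x| * S.
Proof.
move=> Ox Oy yx df.
have [->|xy] := eqVneq y x; first by rewrite !subrr !normr0 mulr0 mul0r.
have d0 : 0 < `|y - x| by rewrite normr_gt0 subr_eq0.
set d := `|y - x| in yx d0 *.
have [e e1 eO] := cone Ox.
pose s := 2 * d / c.
have s0 : 0 < s by rewrite divr_gt0// mulr_gt0.
have sr : s <= r0 by rewrite /s ler_pdivrMr//; lra.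
have cs : c * s = 2 * d by rewrite /s mulrC divfK ?gt_eqF.
have dr : d <= r0.
  by apply: le_trans yx _; rewrite ler_pdivrMr//; have := ler_wpM2r (ltW r0_gt0) c_le1; lra.
have se : `|s *: e| <= s by rewrite normrZ (gtr0_norm s0) ler_piMr// ltW.
have S0 (i : 'I_N) : 0 <= S by have := proj2 (df _ Ox i); exact: le_trans.
have NS0 : 0 <= N%:R * S.
  have [N0|N0] := posnP N; first by rewrite [X in X%:R]N0 mul0r.
  by rewrite mulr_ge0// (S0 (Ordinal N0)).
clear S0.
have leg z : Omega z -> `|z - x| <= r0 -> `|f (z + s *: e) - f z| <= N%:R * s * S.
  move=> Oz zx.
  have /nbhs_ballP[d1 /= d10 d1O] : nbhs z Omega by exact: open_nbhs_nbhs.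
  (* A neighbourhood of the whole climb, of uniform width: up to height d1 / 2 it lies in the ball
     about z, and above that the cone is at least c d1 / 2 wide. *)
  have d2 : 0 < c * d1 / 2 by rewrite divr_gt0// mulr_gt0.
  apply: le_trans (segment_lip d2 _ df) _.
    move=> t w /andP[t0 t1] wd.
    have tse : `|t *: (s *: e)| <= t * s by rewrite normrZ ger0_norm// ler_wpM2l.
    have [small|big] := leP (t * s) (d1 / 2).
      apply: d1O; rewrite -ball_normE /ball_/= distrC.
      rewrite (_ : _ - z = t *: (s *: e) + w); last by apply/rowP => i; rewrite !mxE; ring.
      apply: le_lt_trans (ler_normD _ _) _.
      by have := ler_wpM2r (ltW d10) c_le1; lra.
    rewrite scalerA; apply: eO => //.
      by rewrite (lt_trans _ big) ?divr_gt0//= (le_trans _ sr)// ler_piMl// ltW.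
    apply: ltW; apply: lt_trans wd _.
    by rewrite -mulrA ltr_pM2l.
  by rewrite mulrAC [leRHS]mulrAC ler_wpM2l.
have mid : `|f (y + s *: e) - f (x + s *: e)| <= N%:R * d * S.
  have yxs : y + s *: e - (x + s *: e) = y - x by rewrite opprD addrACA subrr addr0.
  rewrite /d -yxs; apply: (@box_lip _ _ f (x + s *: e) _ _ (c * s)).
  - move=> w wx; apply: df; rewrite -(subrK (x + s *: e) w) addrC.
    by apply: eO => //; rewrite ?subrr ?normr0 ?s0// ltW.
  - by rewrite subrr normr0 mulr_ge0// ltW.
  - by rewrite yxs cs -/d; lra.
have l1 := leg x Ox; rewrite subrr normr0 in l1.
have {}l1 := l1 (ltW r0_gt0).
have l2 := leg y Oy dr.
have -> : f y - f x = - (f (y + s *: e) - f y) + (f (y + s *: e) - f (x + s *: e))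
    + (f (x + s *: e) - f x) by ring.
apply: le_trans (ler_normD _ _) _.
apply: le_trans (lerD (ler_normD _ _) (lexx _)) _.
rewrite normrN.
have -> : 5 * N%:R / c * d * S = 5 * (d / c) * (N%:R * S) by ring.
have sE : s = 2 * (d / c) by rewrite /s mulrA.
have dc : d <= d / c by rewrite ler_pdivlMr// ler_piMr// ltW.
have dNS : N%:R * d * S <= (d / c) * (N%:R * S).
  by rewrite mulrAC mulrC ler_wpM2r.
move: l1 l2 mid dNS; rewrite [X in _ <= N%:R * X * S -> _]sE [X in _ -> _ <= N%:R * X * S -> _]sE.
move: (d / c) (N%:R * d * S) => q M.
have -> : N%:R * (2 * q) * S = 2 * (q * (N%:R * S)) by ring.
by lra.
Qed.

Lemma inner_box x r : Omega x -> 0 < r <= r0 ->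
  exists2 x' : 'rV[R]_N, `|x' - x| <= r & forall z, `|z - x'| <= c * r -> Omega z.
Proof.
move=> Ox /andP[rp rr]; have [e e1 eO] := cone Ox.
exists (x + r *: e).
  by rewrite addrC addKr normrZ (gtr0_norm rp) ler_piMr// ltW.
move=> z zx; rewrite -(subrK (x + r *: e) z) addrC; apply: eO => //.
  by rewrite subrr normr0 ltW.
by rewrite rp.
Qed.

End cone_consequences.

(** Induction on the order, absorbing one a_k at a time. The constants are chosen for the family [F]
    as a whole, which makes them uniform. *)
Lemma chain_interpolation {R : realType} (m : nat) (F : set (nat -> R)) :
  (forall a, F a -> forall k, 0 <= a k) ->
  (forall d : R, 0 < d -> exists2 c : R, 0 <= c & forall a, F a ->
    forall k, (0 < k <= m)%N ->
    a k <= c * \sum_(0 <= i < k) a i + d * \sum_(k.+1 <= i < m.+2) a i) ->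
  exists2 C : R, 1 <= C & forall a, F a -> forall k, (k <= m)%N ->
    a k <= C * (a 0%N + a m.+1).
Proof.
move=> F0 FH.
(* The factor d of the higher terms remains arbitrary, so that the next order can be absorbed; at
   the end k = m and only a_(m+1) is left. *)
suff H k : (k <= m)%N -> forall d : R, 0 < d -> exists2 C : R, 1 <= C &
    forall a, F a -> forall i, (i <= k)%N ->
      a i <= C * a 0%N + d * \sum_(k.+1 <= i < m.+2) a i.
  have [C C1 CH] := H m (leqnn m) 1 ltr01.
  exists C => // a Fa k km; apply: le_trans (CH a Fa k km) _.
  rewrite big_nat1 mul1r mulrDr lerD2l ler_peMl//; exact: F0.
elim: k => [_ d d0|k IH km d d0].
  exists 1 => // a Fa i; rewrite leqn0 => /eqP ->; rewrite mul1r lerDl.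
  by rewrite mulr_ge0 ?(ltW d0)// sumr_ge0// => j _; exact: F0.
have d4 : 0 < d / 4 by rewrite divr_gt0.
have [c c0 cH] := FH _ d4.
pose e : R := Num.min 1 d.
have [e1 ed] : e <= 1 /\ e <= d by rewrite /e !ge_min !lexx orbT.
have e0 : 0 < e by rewrite lt_min ltr01 d0.
have cK : 0 <= c * k.+1%:R by rewrite mulr_ge0.
(* The k + 1 lower terms contribute c (k + 1) d' <= e / 4 times a_(k+1) and times the tail: as e <=
   1 the former is absorbed, as e <= d the latter is within the allowed d. *)
pose d' := e / (4 * (c * k.+1%:R + 1)).
have d'0 : 0 < d' by rewrite divr_gt0// mulr_gt0// ltr_wpDl.
have d'E : d' * (c * k.+1%:R) + d' = e / 4.
  by rewrite /d'; move: (c * k.+1%:R) cK => q q0; field; rewrite gt_eqF// ltr_wpDl.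
have d'1 : 0 <= d' * (c * k.+1%:R) by rewrite mulr_ge0// ltW.
have [C C1 CH] := IH (ltnW km) d' d'0.
exists (C + 2 * (c * k.+1%:R) * C).
  by rewrite -[leLHS]addr0 lerD// !mulr_ge0// (le_trans ler01).
move=> a Fa.
set rho := \sum_(k.+2 <= i < m.+2) a i.
have rho0 : 0 <= rho by rewrite sumr_ge0// => j _; exact: F0.
have {}CH i : (i <= k)%N -> a i <= C * a 0%N + d' * (a k.+1 + rho).
  by move=> /(CH a Fa); rewrite big_ltn; last by lia.
have a0 := F0 a Fa 0%N; have aK := F0 a Fa k.+1.
have C0 : 0 <= C by apply: le_trans C1.
have aKle : a k.+1 <= 2 * (c * k.+1%:R) * C * a 0%N + d * rho.
  have := cH a Fa k.+1 km; rewrite -/rho.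
  have : \sum_(0 <= i < k.+1) a i <= k.+1%:R * (C * a 0%N + d' * (a k.+1 + rho)).
    rewrite mulr_natl big_mkord.
    apply: le_trans (ler_sum _ (fun (i : 'I_k.+1) _ => CH i (ltn_ord i))) _.
    by rewrite sumr_const card_ord.
  move=> /(ler_wpM2l c0); rewrite [X in _ <= X -> _]mulrA.
  have : (c * k.+1%:R) * d' * a k.+1 <= e / 4 * a k.+1 by rewrite ler_wpM2r//; lra.
  have : (c * k.+1%:R) * d' * rho <= e / 4 * rho by rewrite ler_wpM2r//; lra.
  have := ler_wpM2r rho0 ed; have := ler_wpM2r aK e1.
  have : 0 <= d * rho by rewrite mulr_ge0// ltW.
  have : 0 <= c * k.+1%:R * C * a 0%N by rewrite !mulr_ge0.
  move: (c * k.+1%:R) cK => q q0; lra.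
move=> i; rewrite leq_eqVlt => /orP[/eqP->|].
  by apply: le_trans aKle _; rewrite lerD2r ler_wpM2r// lerDr.
rewrite ltnS => /CH ai; apply: le_trans ai _; rewrite [in leRHS]mulrDl.
have qC : 0 <= 2 * (c * k.+1%:R) * C * a 0%N by rewrite !mulr_ge0.
have d'e : d' <= e / 4 by lra.
have d'd : d' * d * rho <= d / 4 * rho.
  by rewrite ler_wpM2r//; have := ler_wpM2r (ltW d0) d'e; have := ler_wpM2r (ltW d0) e1; lra.
have := ler_wpM2l (ltW d'0) aKle.
have : d' * (2 * (c * k.+1%:R) * C * a 0%N) <= 1 * (2 * (c * k.+1%:R) * C * a 0%N).
  by rewrite ler_wpM2r//; lra.
have : d' * rho <= d / 4 * rho by rewrite ler_wpM2r//; lra.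
have : 0 <= d * rho by rewrite mulr_ge0// ltW.
move: (2 * (c * k.+1%:R) * C * a 0%N) qC => q q0; lra.
Qed.

(** * Commuting partial derivatives *)

Section commutation.
Context {R : realType} {V : normedModType R}.
Implicit Types (U : set V) (f g : V -> R) (vs pre suf : seq V).

(* Schwarz' theorem moves the innermost direction [l] outwards, one place at a
   time. *)
Lemma dderiv_insert U f pre suf l : open U ->
  dderivable U (pre ++ suf) f -> dderivable U (pre ++ l :: suf) f ->
  (forall k z, U z -> {for z, continuous (dderiv (drop k pre ++ l :: suf) f)}) ->
  forall z, U z -> derivable (dderiv (pre ++ suf) f) z l /\
    'D_l (dderiv (pre ++ suf) f) z = dderiv (pre ++ l :: suf) f z.
Proof.
move=> oU; elim: pre => [|a pre IH] /=.
  by move=> _ [_ dl] _ z Uz; split=> //; exact: dl.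
move=> [d1 da] [d2 daG] cont.
have {}IH := IH d1 d2 (fun k => cont k.+1).
move=> z Uz.
have nearE x : U x -> {near x, 'D_l (dderiv (pre ++ suf) f) =1 dderiv (pre ++ l :: suf) f}.
  move=> Ux; have : nbhs x U by exact: open_nbhs_nbhs.
  by apply: filterS => y Uy; case: (IH _ Uy).
have DE x : U x -> 'D_a ('D_l (dderiv (pre ++ suf) f)) x =
    'D_a (dderiv (pre ++ l :: suf) f) x.
  by move=> Ux; apply: near_eq_derive; exact: nearE.
have [] := @schwarz R V (dderiv (pre ++ suf) f) U z a l oU Uz da.
- by move=> y Uy; case: (IH _ Uy).
- move=> y Uy; apply: near_eq_derivable (daG _ Uy).
  by have := nearE _ Uy; apply: filterS => w ->.
- rewrite -[{for z, _}]/('D_a ('D_l (dderiv (pre ++ suf) f)) y @[y --> z] -->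
    'D_a ('D_l (dderiv (pre ++ suf) f)) z) DE//.
  apply: cvg_trans (cont 0%N z Uz); apply: near_eq_cvg.
  have : nbhs z U by exact: open_nbhs_nbhs.
  by apply: filterS => y Uy; rewrite DE.
by move=> dd ->; rewrite DE.
Qed.

End commutation.

Lemma sorted_insert n (s : seq 'I_n) i : sorted (@ole n) s ->
  exists s1 s2, s = s1 ++ s2 /\ sorted (@ole n) (s1 ++ i :: s2).
Proof.
elim: s => [|k s IH] ss; first by exists [::], [::].
have [ik|ki] := leqP i k.
  by exists [::], (k :: s); split=> //=; rewrite /ole ik.
have /= := ss; move=> /path_sorted/IH[s1 [s2 [E so]]].
exists (k :: s1), s2; split; first by rewrite E.
case: s1 E so => [|k1 s1] /= E so; first by rewrite {1}/ole ltnW.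
by rewrite so andbT; move: ss; rewrite E /= => /andP[].
Qed.

Lemma sorted_drop (T : Type) (e : rel T) k (s : seq T) : sorted e s -> sorted e (drop k s).
Proof.
elim: k s => [|k IH] [|x s] //= ss; apply: IH; exact: path_sorted ss.
Qed.

(** * Derivatives of u in sorted order *)

Section parabolic_derivatives.
Context {R : realType} {N : nat}.
Variables (Omega : set 'rV[R]_N) (T : R) (m : nat) (u : 'rV[R]_N * R -> R).
Hypothesis oOmega : open Omega.
Implicit Types (j : nat) (s : seq 'I_N) (z : 'rV[R]_N * R).

Definition tdir : 'rV[R]_N * R := (0, 1).
Definition xdir (i : 'I_N) : 'rV[R]_N * R := (delta_mx 0 i, 0).
Definition jdirs j s : seq ('rV[R]_N * R) := nseq j tdir ++ map xdir s.
Definition jderiv j s : 'rV[R]_N * R -> R := dderiv (jdirs j s) u.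

Lemma par_dirsE j beta : par_dirs j beta = jdirs j (idx_seq beta).
Proof. by rewrite /par_dirs multi_dirs_idx. Qed.

Lemma open_cyl : open (cyl Omega T).
Proof.
have -> : cyl Omega T = fst @^-1` Omega `&` snd @^-1` `]0, T[%classic by [].
apply: openI; apply: open_comp => //.
- by move=> z _; exact: cvg_fst.
- by move=> z _; exact: cvg_snd.
Qed.

Hypothesis Cu : C_par Omega T m u.

Lemma C_par_jderiv j s : sorted (@ole N) s -> (size s + 2 * j <= m)%N ->
  [/\ dderivable (cyl Omega T) (jdirs j s) u,
    forall z, cyl Omega T z -> {for z, continuous (jderiv j s)} &
    forall z, ccyl Omega T z -> cvg (jderiv j s w @[w --> within (cyl Omega T) (nbhs z)])].
Proof.
move=> ss sm; have := proj2 Cu j (fun i => count_mem i s).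
by rewrite par_dirsE idx_seq_count// /par_order msize_count; apply.
Qed.

Lemma jderiv_time j s z : sorted (@ole N) s -> (size s + 2 * j.+1 <= m)%N ->
  cyl Omega T z -> derivable (jderiv j s) z tdir /\
    'D_tdir (jderiv j s) z = jderiv j.+1 s z.
Proof.
move=> ss sm cz; have [/= [_ d] _ _] := C_par_jderiv ss sm.
by split=> //; exact: d.
Qed.

Lemma jderiv_space0 i s z : sorted (@ole N) (i :: s) -> ((size s).+1 <= m)%N ->
  cyl Omega T z -> derivable (jderiv 0 s) z (xdir i) /\
    'D_(xdir i) (jderiv 0 s) z = jderiv 0 (i :: s) z.
Proof.
move=> ss sm cz; have [|/= [_ d] _ _] := @C_par_jderiv 0 (i :: s) ss.
  by rewrite muln0 addn0.
by split=> //; exact: d.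
Qed.

(** [C_par] says nothing directly about D_(x_i) applied last. It is commuted inwards to its sorted
    place, giving s'; the derivatives met on the way are again sorted and of lower order, hence
    continuous. *)
Lemma jderiv_space j s i : sorted (@ole N) s -> (size s + 2 * j < m)%N ->
  exists s', [/\ sorted (@ole N) s', size s' = (size s).+1 &
    forall z, cyl Omega T z -> derivable (jderiv j s) z (xdir i) /\
      'D_(xdir i) (jderiv j s) z = jderiv j s' z].
Proof.
move=> ss sm; have [s1 [s2 [E ss']]] := sorted_insert i ss.
have sz : size (s1 ++ i :: s2) = (size s).+1 by rewrite E !size_cat addnS.
exists (s1 ++ i :: s2); split=> //.
have -> : jderiv j (s1 ++ i :: s2) =
    dderiv ((nseq j tdir ++ map xdir s1) ++ xdir i :: map xdir s2) u.
  by rewrite /jderiv /jdirs map_cat catA.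
have -> : jderiv j s = dderiv ((nseq j tdir ++ map xdir s1) ++ map xdir s2) u.
  by rewrite /jderiv /jdirs E map_cat catA.
apply: dderiv_insert; first exact: open_cyl.
- have [|+ _ _] := @C_par_jderiv j s ss; first exact: ltnW.
  by rewrite /jdirs E map_cat catA.
- have [|+ _ _] := @C_par_jderiv j _ ss'; first by rewrite sz.
  by rewrite /jdirs map_cat catA.
move=> k z cz.
(* Truncated subtraction covers both cases: [drop k] removes time derivatives first, and space
   directions only once these are exhausted. *)
have -> : drop k (nseq j tdir ++ map xdir s1) ++ xdir i :: map xdir s2 =
    jdirs (j - k) (drop (k - j) s1 ++ i :: s2).
  rewrite drop_cat size_nseq /jdirs map_cat /= catA; congr (_ ++ _).
  case: ltnP => kj; first by rewrite drop_nseq (eqP (ltnW kj)) drop0.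
  by rewrite map_drop (eqP kj).
have [||_ + _] := @C_par_jderiv (j - k) (drop (k - j) s1 ++ i :: s2).
- have := sorted_drop (k - j) ss'; rewrite drop_cat.
  case: ltnP => // kj _; rewrite drop_oversize//.
  by have := sorted_drop (size s1) ss'; rewrite drop_size_cat.
- move: sm; rewrite E !size_cat /= size_drop; lia.
by apply.
Qed.

End parabolic_derivatives.

(** * Oscillation and interpolation *)

Section slices.
Context {R : realType} {V W : normedModType R}.
Implicit Type f : V * W -> R.

Lemma slice_derive1 f x (t : W) (v : V) : derivable f (x, t) (v, 0) ->
  derivable (fun x => f (x, t)) x v /\
  'D_v (fun x => f (x, t)) x = 'D_((v, 0) : V * W) f (x, t).
Proof.
have E : (fun h : R => h^-1 *: (((fun x => f (x, t)) \o shift x) (h *: v) - f (x, t)))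
   = (fun h : R => h^-1 *: ((f \o shift (x, t)) (h *: ((v, 0) : V * W)) - f (x, t))).
  apply/funext => h /=; congr (_ *: (f _ - _)).
  by rewrite /shift /=; congr pair; rewrite /= scaler0 add0r.
by rewrite /derivable /derive E.
Qed.

End slices.

Lemma powRD_gt0 {R : realType} (x r s : R) : 0 < x -> x `^ (r + s) = x `^ r * x `^ s.
Proof. by move=> x0; rewrite powRD// (gt_eqF x0) implybT. Qed.

Section oscillation.
Context {R : realType} {N : nat}.
Variables (Omega : set 'rV[R]_N) (T : R) (m : nat) (al r0 c : R).
Hypotheses (r0_gt0 : 0 < r0) (c_gt0 : 0 < c) (c_le1 : c <= 1).
Hypotheses (al_gt0 : 0 < al) (al_lt1 : al < 1) (N_gt0 : (0 < N)%N).
Hypotheses (oOmega : open Omega) (cone : cone_condition Omega r0 c).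
Implicit Types (u : 'rV[R]_N * R -> R) (A h th : R).

Local Notation Cyl := (cyl Omega T).
Local Notation srt := (sorted (@ole N)).

(** In x only the top order m is listed, since below it the mean value theorem is available. In t
    the order m - 1 is listed too, because one more D_t would exceed the order m. *)
Definition hoelder_bounds A u : Prop :=
 [/\ forall j s z, srt s -> (size s + 2 * j <= m)%N -> Cyl z -> `|jderiv u j s z| <= A,
   forall j s x y t, srt s -> (size s + 2 * j = m)%N -> Cyl (x, t) -> Cyl (y, t) ->
     `|jderiv u j s (x, t) - jderiv u j s (y, t)| <= A * enorm (x - y) `^ al &
   forall j s x t t', srt s -> (size s + 2 * j <= m <= (size s + 2 * j).+1)%N ->
     Cyl (x, t) -> Cyl (x, t') ->
     `|jderiv u j s (x, t) - jderiv u j s (x, t')| <=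
       A * `|t - t'| `^ (((m - (size s + 2 * j))%:R + al) / 2)].

(* 0 keeps the set nonempty, whatever the cylinder. *)
Definition ordset u k := [set r | r = 0 \/ exists j s z,
  [/\ srt s, (size s + 2 * j)%N = k, Cyl z & r = `|jderiv u j s z|]].

Definition ordsup u k : R := sup (ordset u k).

(* All orders [k > m] stand for the top order [m + al]. *)
Definition scaled A u h k : R :=
  if (k <= m)%N then h ^+ k * ordsup u k else h `^ (m%:R + al) * A.

Section one_function.
Variables (u : 'rV[R]_N * R -> R) (A : R).
Hypotheses (Cu : C_par Omega T m u) (A_ge0 : 0 <= A) (uA : hoelder_bounds A u).

Lemma ordset_bounded k : (k <= m)%N -> has_sup (ordset u k).
Proof.
move=> km; split; first by exists 0; left.
exists A => r [->//|[j [s [z [ss sk cz ->]]]]].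
by case: uA => + _ _; apply=> //; rewrite sk.
Qed.

Lemma ordsup_ge0 k : (k <= m)%N -> 0 <= ordsup u k.
Proof. by move=> km; apply: sup_upper_bound; [exact: ordset_bounded|left]. Qed.

Lemma jderiv_le_ordsup j s z : srt s -> (size s + 2 * j <= m)%N -> Cyl z ->
  `|jderiv u j s z| <= ordsup u (size s + 2 * j).
Proof.
move=> ss sm cz; apply: sup_upper_bound; first exact: ordset_bounded.
by right; exists j, s, z.
Qed.

Lemma ordsup_le k B : 0 <= B ->
  (forall j s z, srt s -> (size s + 2 * j)%N = k -> Cyl z -> `|jderiv u j s z| <= B) ->
  ordsup u k <= B.
Proof.
move=> B0 H; apply: ge_sup; first by exists 0; left.
by move=> r [->//|[j [s [z [ss sk cz ->]]]]]; exact: H.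
Qed.

Lemma scaled_ge0 h k : 0 <= h -> 0 <= scaled A u h k.
Proof.
move=> h0; rewrite /scaled; case: ifPn => km.
  by rewrite mulr_ge0 ?exprn_ge0// ordsup_ge0.
by rewrite mulr_ge0// powR_ge0.
Qed.

(** [xexp] and [texp] are the powers of theta gained by a space step theta h and a time step (theta
    h)^2 at order k: those of the mean value theorem as long as the next derivative has order at
    most m, those of the Hoelder bounds beyond. *)
Definition xexp k : R := if (k < m)%N then 1 else al.
Definition texp k : R := if (k.+1 < m)%N then 2 else (m - k)%:R + al.

(** Multiplication by h^k turns the increment h theta sup |D^(k+1) u| into theta a_(k+1). The factor
    10 is twice the 5 of [cone_lip], for a distance up to 2 theta h; h <= c r0 / 4 keeps this
    distance within the range of that lemma. *)
Lemma osc_x j s x y t h th : srt s -> (size s + 2 * j <= m)%N ->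
  Cyl (x, t) -> Cyl (y, t) -> 0 < h -> 0 < th <= 1 -> h <= c * r0 / 4 ->
  `|x - y| <= 2 * (th * h) ->
  h ^+ (size s + 2 * j) * `|jderiv u j s (x, t) - jderiv u j s (y, t)| <=
    10 * N%:R / c * th `^ xexp (size s + 2 * j) * scaled A u h (size s + 2 * j).+1.
Proof.
set k := (size s + 2 * j)%N => ss sm cx cy h0 /andP[th0 th1] hr xy.
have hk : 0 <= h ^+ k by rewrite exprn_ge0// ltW.
have N1 : 1 <= N%:R :> R by rewrite ler1n.
rewrite /xexp /scaled; case: ltnP => km.
  have S0 := ordsup_ge0 km.
  have : `|jderiv u j s (x, t) - jderiv u j s (y, t)| <=
      5 * N%:R / c * `|x - y| * ordsup u k.+1.
    apply: (@cone_lip _ _ Omega r0 c _ _ _ _ _ (fun x => jderiv u j s (x, t))) => //.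
    - by case: cy.
    - by case: cx.
    - apply: le_trans xy _; apply: le_trans (_ : 2 * (1 * h) <= _).
        by rewrite ler_wpM2l// ler_wpM2r// ltW.
      by lra.
    move=> z Oz i; have [s' [ss' sz E]] := jderiv_space oOmega Cu i ss km.
    have cz : Cyl (z, t) by split=> //; case: cx.
    have [/slice_derive1[d1 d2] D] := E _ cz.
    split=> //; rewrite d2 D -/(xdir i).
    have -> : k.+1 = (size s' + 2 * j)%N by rewrite sz.
    by apply: jderiv_le_ordsup => //; rewrite sz.
  move=> H; apply: le_trans (ler_wpM2l hk H) _.
  rewrite powRr1 ?(ltW th0)//.
  have -> : 10 * N%:R / c * th * (h ^+ k.+1 * ordsup u k.+1) =
    h ^+ k * (5 * N%:R / c * (2 * (th * h)) * ordsup u k.+1) by rewrite exprS; ring.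
  rewrite ler_wpM2l// ler_wpM2r// ler_wpM2l//.
  by rewrite divr_ge0 ?mulr_ge0// ltW.
have kE : k = m by apply/eqP; rewrite eqn_leq sm.
have [_ + _] := uA; move=> /(_ j s x y t ss kE cx cy) H.
apply: le_trans (ler_wpM2l hk H) _.
have -> : h `^ (m%:R + al) = h ^+ k * h `^ al.
  by rewrite powRD_gt0// powR_mulrn ?kE// ltW.
(* The factor 2 N >= 1 leaves the power al < 1 at the cost of an increase. *)
have E1 : enorm (x - y) `^ al <= (2 * N%:R) * (th `^ al * h `^ al).
  apply: (@le_trans _ _ ((2 * N%:R * (th * h)) `^ al)).
    apply: ge0_ler_powR; rewrite ?nnegrE ?enorm_ge0//; first exact: ltW.
      by rewrite !mulr_ge0// ltW.
    apply: le_trans (enorm_le _) _.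
    by rewrite [2 * _]mulrC -mulrA ler_wpM2l.
  have th0' := ltW th0; have h0' := ltW h0.
  rewrite powRM ?mulr_ge0// [(th * h) `^ _]powRM// ler_wpM2r ?mulr_ge0 ?powR_ge0//.
  by apply: ler1_powR; [lra|exact: ltW].
have -> : 10 * N%:R / c * th `^ al * (h ^+ k * h `^ al * A) =
  h ^+ k * (A * (10 * N%:R / c * (th `^ al * h `^ al))) by ring.
rewrite ler_wpM2l// ler_wpM2l//; apply: le_trans E1 _.
rewrite ler_wpM2r ?mulr_ge0 ?powR_ge0// ler_pdivlMr//.
apply: (@le_trans _ _ (2 * N%:R * 1)); last by lra.
by rewrite ler_wpM2l ?mulr_ge0.
Qed.

(** Segments in time stay in the cylinder, so the cone is not involved. A time derivative raises the
    order by two; from order m - 1 on, the index k + 2 designates the top seminorm. *)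
Lemma osc_t j s x t t' h th : srt s -> (size s + 2 * j <= m)%N ->
  Cyl (x, t) -> Cyl (x, t') -> 0 < h -> 0 < th <= 1 ->
  `|t - t'| <= (th * h) ^+ 2 ->
  h ^+ (size s + 2 * j) * `|jderiv u j s (x, t) - jderiv u j s (x, t')| <=
    th `^ texp (size s + 2 * j) * scaled A u h (size s + 2 * j).+2.
Proof.
set k := (size s + 2 * j)%N => ss sm cx cx' h0 /andP[th0 th1] tt.
have hk : 0 <= h ^+ k by rewrite exprn_ge0// ltW.
rewrite /texp /scaled; case: ltnP => km.
  have S0 := ordsup_ge0 km.
  have sm' : (size s + 2 * j.+1 <= m)%N by rewrite mulnS addnCA -/k.
  have inC r : 0 <= r * (t - t') -> `|r| <= `|t - t'| -> Cyl (r *: tdir + (x, t')).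
    move=> r1 r2; have -> : r *: tdir + (x, t') = (x, r + t').
      rewrite /tdir; congr pair; rewrite /= ?scaler0 ?add0r//.
      by rewrite -[r *: 1]/(r * 1) mulr1.
    split; first by case: cx.
    move: cx cx' => [_ /=] + [_ /=]; rewrite !in_itv /= => /andP[a1 a2] /andP[b1 b2].
    move: r1 r2; have [d0|d0] := leP 0 (t - t').
      have [r1|r1] := leP 0 r; first by rewrite !ger0_norm//; lra.
      have [->|dn0] := eqVneq (t - t') 0; first by rewrite normr0 normr_le0 => _ /eqP ->; lra.
      have dp : 0 < t - t' by rewrite lt_neqAle eq_sym dn0 d0.
      by rewrite leNgt nmulr_rlt0// dp.
    have [r1|r1] := leP r 0; first by rewrite (ler0_norm r1) (ltr0_norm d0); lra.
    by rewrite leNgt pmulr_rlt0// d0.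
  have : `|jderiv u j s (x, t) - jderiv u j s (x, t')| <= `|t - t'| * ordsup u k.+2.
    have -> : (x, t) = (t - t') *: tdir + (x, t') :> 'rV[R]_N * R.
      rewrite /tdir; congr pair; rewrite /= ?scaler0 ?add0r//.
      by rewrite -[(t - t') *: 1]/((t - t') * 1) mulr1 subrK.
    apply: mvt_dir_le => r r1 r2; have [d D] := jderiv_time Cu ss sm' (inC _ r1 r2) => //.
    have -> : k.+2 = (size s + 2 * j.+1)%N by rewrite mulnS addnCA.
    by rewrite D; apply: jderiv_le_ordsup => //; exact: inC.
  move=> H; apply: le_trans (ler_wpM2l hk H) _.
  have -> : th `^ 2 * (h ^+ k.+2 * ordsup u k.+2) = h ^+ k * ((th * h) ^+ 2 * ordsup u k.+2).
    by rewrite -[2]/(2%:R) powR_mulrn ?(ltW th0)// !exprS; ring.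
  by rewrite ler_wpM2l// ler_wpM2r.
have [_ _ H] := uA.
have mk : (size s + 2 * j <= m <= (size s + 2 * j).+1)%N by rewrite sm km.
have {}H := H j s x t t' ss mk cx cx'.
apply: le_trans (ler_wpM2l hk H) _; rewrite -/k.
have e0 : 0 <= (m - k)%:R + al by rewrite addr_ge0// ltW.
have -> : h `^ (m%:R + al) = h ^+ k * h `^ ((m - k)%:R + al).
  rewrite -powR_mulrn ?(ltW h0)// -powRD_gt0//.
  by rewrite addrA -natrD subnKC.
have E1 : `|t - t'| `^ (((m - k)%:R + al) / 2) <= th `^ ((m - k)%:R + al) * h `^ ((m - k)%:R + al).
  have th0' := ltW th0; have h0' := ltW h0.
  rewrite -powRM//; apply: (@le_trans _ _ (((th * h) ^+ 2) `^ (((m - k)%:R + al) / 2))).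
    by apply: ge0_ler_powR; rewrite ?nnegrE ?divr_ge0// exprn_ge0 ?mulr_ge0.
  by rewrite -powR_mulrn ?mulr_ge0// -powRrM [_%:R * (_ / _)]mulrC divfK.
have -> : th `^ ((m - k)%:R + al) * (h ^+ k * h `^ ((m - k)%:R + al) * A) =
  h ^+ k * (A * (th `^ ((m - k)%:R + al) * h `^ ((m - k)%:R + al))) by ring.
by rewrite ler_wpM2l// ler_wpM2l.
Qed.

End one_function.
End oscillation.

Lemma small_scale {R : realType} (C d al : R) : 0 < C -> 0 < d -> 0 < al ->
  exists2 th, 0 < th <= 1 & C * th `^ al <= d.
Proof.
move=> C0 d0 al0; have dC : 0 < d / C by rewrite divr_gt0.
exists (Num.min 1 ((d / C) `^ al^-1)).
  by rewrite lt_min ltr01 powR_gt0// ge_min lexx.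
rewrite mulrC -ler_pdivlMr//; apply: (@le_trans _ _ (((d / C) `^ al^-1) `^ al)).
  apply: ge0_ler_powR; rewrite ?nnegrE ?powR_ge0// ?(ltW al0)//.
    by rewrite le_min ler01 powR_ge0.
  by rewrite ge_min lexx orbT.
by rewrite -powRrM mulVf ?gt_eqF// powRr1// ltW.
Qed.

Lemma le_bignat_term {R : realType} (a : nat -> R) p q k : (forall i, 0 <= a i) ->
  (p <= k < q)%N -> a k <= \sum_(p <= i < q) a i.
Proof.
move=> a0 /andP[pk kq]; rewrite (big_cat_nat pk (ltnW kq))/=.
by rewrite (big_ltn kq) addrCA lerDl addr_ge0// sumr_ge0.
Qed.

(** * Interpolation between the orders at a fixed scale *)

Section interpolation.
Context {R : realType} {N : nat}.
Variables (Omega : set 'rV[R]_N) (T : R) (m : nat) (al r0 c : R).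
Hypotheses (r0_gt0 : 0 < r0) (c_gt0 : 0 < c) (c_le1 : c <= 1).
Hypotheses (al_gt0 : 0 < al) (al_lt1 : al < 1) (N_gt0 : (0 < N)%N) (T_gt0 : 0 < T).
Hypotheses (oOmega : open Omega) (cone : cone_condition Omega r0 c).
Implicit Types (u : 'rV[R]_N * R -> R) (A h th : R).

Local Notation Cyl := (cyl Omega T).
Local Notation srt := (sorted (@ole N)).
Local Notation ordsup := (ordsup Omega T).
Local Notation scaled_at := (scaled Omega T m al).
Local Notation hoelder_bounds := (hoelder_bounds Omega T m al).

(** c r0 / 4 keeps steps within reach of the cone condition, T / 4 leaves room for a step in time on
    one side, and 1 gives h^2 <= h and orders the powers of h. *)
Definition max_scale : R := Num.min 1 (Num.min (c * r0 / 4) (T / 4)).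

Lemma max_scale_gt0 : 0 < max_scale.
Proof. by rewrite !lt_min ltr01 !divr_gt0// mulr_gt0. Qed.

Lemma le_max_scale h : h <= max_scale -> [/\ h <= 1, h <= c * r0 / 4 & h <= T / 4].
Proof. by rewrite !le_min => /andP[-> /andP[-> ->]]. Qed.

Section one_function.
Variables (u : 'rV[R]_N * R -> R) (A h : R).
Hypotheses (Cu : C_par Omega T m u) (A_ge0 : 0 <= A) (uA : hoelder_bounds A u).
Hypotheses (h_gt0 : 0 < h) (h_le : h <= max_scale).

Lemma scaled_pos k : 0 <= scaled_at A u h k.
Proof. exact: (scaled_ge0 A_ge0 uA k (ltW h_gt0)). Qed.

Let C1 : R := 10 * N%:R / c.

Let C1_ge1 : 1 <= C1.
Proof.
rewrite /C1 ler_pdivlMr// mul1r; apply: le_trans c_le1 _.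
have : 1 <= N%:R :> R by rewrite ler1n.
by lra.
Qed.

Lemma xexp_ge k : al <= xexp m al k.
Proof. by rewrite /xexp; case: ifP => _ //; exact: ltW. Qed.

Lemma texp_ge k : al <= texp m al k.
Proof. by rewrite /texp; case: ifP => _; [by rewrite (le_trans (ltW al_lt1))// ler1n|by rewrite lerDr]. Qed.

Lemma osc_x_al j s x y t th : srt s -> (size s + 2 * j <= m)%N ->
  Cyl (x, t) -> Cyl (y, t) -> 0 < th <= 1 -> `|x - y| <= 2 * (th * h) ->
  h ^+ (size s + 2 * j) * `|jderiv u j s (x, t) - jderiv u j s (y, t)| <=
    C1 * th `^ al * scaled_at A u h (size s + 2 * j).+1.
Proof.
move=> ss sm cx cy th01 xy; have [_ h2 _] := le_max_scale h_le.
have := osc_x r0_gt0 c_gt0 c_le1 al_gt0 al_lt1 N_gt0 oOmega cone Cu A_ge0 uA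
  ss sm cx cy h_gt0 th01 h2 xy.
move/le_trans; apply; rewrite ler_wpM2r ?scaled_pos// ler_wpM2l//.
  exact: le_trans C1_ge1.
exact: ger_powR (xexp_ge _).
Qed.

Lemma osc_t_al j s x t t' th : srt s -> (size s + 2 * j <= m)%N ->
  Cyl (x, t) -> Cyl (x, t') -> 0 < th <= 1 -> `|t - t'| <= (th * h) ^+ 2 ->
  h ^+ (size s + 2 * j) * `|jderiv u j s (x, t) - jderiv u j s (x, t')| <=
    th `^ al * scaled_at A u h (size s + 2 * j).+2.
Proof.
move=> ss sm cx cx' th01 tt.
have := osc_t al_gt0 Cu A_ge0 uA ss sm cx cx' h_gt0 th01 tt.
move/le_trans; apply; rewrite ler_wpM2r ?scaled_pos//.
exact: ger_powR (texp_ge _).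
Qed.

(** In the box that the cone provides near x, the mean value theorem along i yields a point where
    D_i D^s u is at most 2 sup |D^s u| / (c theta h); this point is within 2 theta h of x, and
    [osc_x_al] leads back to x. Only j = 0 is treated: a time derivative, being outermost, is
    removed by [time_step] instead. *)
Lemma space_step i s z th : srt (i :: s) -> ((size s).+1 <= m)%N -> Cyl z ->
  0 < th <= 1 ->
  h ^+ (size s).+1 * `|jderiv u 0 (i :: s) z| <=
    2 / c * th^-1 * scaled_at A u h (size s) + C1 * th `^ al * scaled_at A u h (size s).+2.
Proof.
case: z => x t ss sm cx /[dup] th01 /andP[th0 th1].
have [_ h2 _] := le_max_scale h_le.
have r_gt0 : 0 < th * h by rewrite mulr_gt0.
have r_le : th * h <= r0.
  have : th * h <= 1 * h by rewrite ler_wpM2r// ltW.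
  by have := ler_wpM2r (ltW r0_gt0) c_le1; have := r0_gt0; lra.
have [Ox tT] := cx.
have [x' x'x box] := inner_box r0_gt0 cone Ox (introT andP (conj r_gt0 r_le)).
have cr0 : 0 < c * (th * h) by rewrite mulr_gt0.
have ptE (r : R) : r *: xdir i + (x', t) = (r *: delta_mx 0 i + x', t).
  by rewrite /xdir; congr pair; rewrite /= scaler0 add0r.
have inE r : `|r| <= `|c * (th * h)| -> `|r *: delta_mx 0 i + x' - x'| <= c * (th * h).
  rewrite (gtr0_norm cr0) addrK => rc; rewrite normrZ -[leRHS]mulr1.
  by rewrite ler_pM// norm_delta_mx.
have inC r : `|r| <= `|c * (th * h)| -> Cyl (r *: xdir i + (x', t)).
  by move=> /inE rc; rewrite ptE; split=> //=; apply: box.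
have s_srt : srt s by exact: path_sorted ss.
have [|r [_ rc E]] := @mvt_dir _ _ (jderiv u 0 s) (x', t) (xdir i) (c * (th * h)).
  by move=> r _ /inC cr; case: (jderiv_space0 Cu ss sm cr).
have [_ DE] := jderiv_space0 Cu ss sm (inC _ rc).
have {}E := etrans E (congr1 ( *%R _) DE).
have sle z : Cyl z -> `|jderiv u 0 s z| <= ordsup u (size s).
  move=> cz; have := @jderiv_le_ordsup _ _ _ _ _ _ _ _ A_ge0 uA 0 s z s_srt.
  by rewrite muln0 addn0; apply=> //; exact: ltnW.
have yb : `|jderiv u 0 (i :: s) (r *: xdir i + (x', t))| <= 2 / (c * (th * h)) * ordsup u (size s).
  have := congr1 Num.norm E; rewrite normrM (gtr0_norm cr0) => {}E.
  rewrite mulrAC ler_pdivlMr// mulrC -E mulr2n mulrDl mul1r.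
  apply: le_trans (ler_normB _ _) _; apply: lerD; apply: sle.
    by apply: inC.
  by have := inC 0; rewrite normr0 scale0r add0r; apply.
have cy := inC r rc.
have xy : `|x - (r *: delta_mx 0 i + x')| <= 2 * (th * h).
  have -> : x - (r *: delta_mx 0 i + x') = - ((r *: delta_mx 0 i + x' - x') + (x' - x)).
    by apply/rowP => l; rewrite !mxE; ring.
  rewrite normrN; apply: le_trans (ler_normD _ _) _.
  have := inE _ rc; have : c * (th * h) <= 1 * (th * h) by rewrite ler_wpM2r// ltW.
  by lra.
have := @osc_x_al 0 (i :: s) x (r *: delta_mx 0 i + x') t th ss.
rewrite muln0 addn0 -ptE => /(_ sm cx cy th01 xy) osc.
rewrite -(subrK (jderiv u 0 (i :: s) (r *: xdir i + (x', t))) (jderiv u 0 (i :: s) (x, t))).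
have hk : 0 <= h ^+ (size s).+1 by rewrite exprn_ge0// ltW.
apply: le_trans (ler_wpM2l hk (ler_normD _ _)) _.
rewrite mulrDr addrC lerD//.
apply: le_trans (ler_wpM2l hk yb) _.
rewrite /scaled (ltnW sm) exprS le_eqVlt; apply/orP; left; apply/eqP.
by field; rewrite !gt_eqF.
Qed.

Lemma time_step j s z th : srt s -> (size s + 2 * j.+1 <= m)%N -> Cyl z ->
  0 < th <= 1 ->
  h ^+ (size s + 2 * j.+1) * `|jderiv u j.+1 s z| <=
    2 * th ^- 2 * scaled_at A u h (size s + 2 * j) +
    th `^ al * scaled_at A u h (size s + 2 * j.+1).+2.
Proof.
case: z => x t ss sm cx /[dup] th01 /andP[th0 th1].
have [h1 _ hT] := le_max_scale h_le.
have r_gt0 : 0 < th * h by rewrite mulr_gt0.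
have d0 : 0 < (th * h) ^+ 2 by rewrite exprn_gt0.
have dT : (th * h) ^+ 2 <= T / 4.
  apply: le_trans hT; rewrite exprMn -[leRHS]mul1r ler_pM ?exprn_ge0 ?(ltW th0) ?(ltW h_gt0)//.
    by rewrite exprn_ile1// ltW.
  by rewrite expr2 ler_piMl// ltW.
have [Ox /= tT] := cx; move: tT; rewrite in_itv /= => /andP[t0 t1].
(* Forward in the first half of the time interval, backward in the second. *)
have [d [dn dC]] : exists d : R, `|d| = (th * h) ^+ 2 /\
    forall r, 0 <= r * d -> `|r| <= `|d| -> Cyl (r *: tdir + (x, t)).
  have ptE (r : R) : r *: tdir + (x, t) = (x, r + t) :> 'rV[R]_N * R.
    by rewrite /tdir; congr pair; rewrite /= ?scaler0 ?add0r// -[r *: 1]/(r * 1) mulr1.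
  have [tl|tg] := leP t (T / 2).
    exists ((th * h) ^+ 2); split; first by rewrite gtr0_norm.
    move=> r; rewrite pmulr_lge0// => rr; rewrite (gtr0_norm d0) ger0_norm// ptE => rd.
    by split=> //=; rewrite in_itv /=; lra.
  exists (- (th * h) ^+ 2); split; first by rewrite normrN gtr0_norm.
  move=> r; rewrite mulrN oppr_ge0 pmulr_lle0// => rr.
  rewrite normrN (gtr0_norm d0) ler0_norm// ptE => rd.
  by split=> //=; rewrite in_itv /=; lra.
have [|r [r0' rd E]] := @mvt_dir _ _ (jderiv u j s) (x, t) tdir d.
  by move=> r ra rb; case: (jderiv_time Cu ss sm (dC _ ra rb)).
have cy := dC r r0' rd.
have [_ DE] := jderiv_time Cu ss sm cy; have {}E := etrans E (congr1 ( *%R d) DE).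
have sm' : (size s + 2 * j <= m)%N by apply: leq_trans sm; rewrite leq_add2l leq_mul2l leqnSn orbT.
have sle z : Cyl z -> `|jderiv u j s z| <= ordsup u (size s + 2 * j).
  by move=> cz; exact: (jderiv_le_ordsup A_ge0 uA).
have yb : `|jderiv u j.+1 s (r *: tdir + (x, t))| <= 2 / (th * h) ^+ 2 * ordsup u (size s + 2 * j).
  have := congr1 Num.norm E; rewrite normrM dn => {}E.
  rewrite mulrAC ler_pdivlMr// mulrC -E mulr2n mulrDl mul1r.
  apply: le_trans (ler_normB _ _) _; apply: lerD; apply: sle => //.
  by apply: dC => //; rewrite -expr2 sqr_ge0.
have yE : r *: tdir + (x, t) = (x, r + t) :> 'rV[R]_N * R.
  by rewrite /tdir; congr pair; rewrite /= ?scaler0 ?add0r// -[r *: 1]/(r * 1) mulr1.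
rewrite yE in yb cy.
have tt : `|t - (r + t)| <= (th * h) ^+ 2.
  by rewrite opprD addrCA subrr addr0 normrN -dn.
have osc := osc_t_al ss sm cx cy th01 tt.
rewrite -(subrK (jderiv u j.+1 s (x, r + t)) (jderiv u j.+1 s (x, t))).
have hk : 0 <= h ^+ (size s + 2 * j.+1) by rewrite exprn_ge0// ltW.
apply: le_trans (ler_wpM2l hk (ler_normD _ _)) _.
rewrite mulrDr addrC lerD//.
apply: le_trans (ler_wpM2l hk yb) _.
rewrite /scaled sm' mulnS addnCA exprD.
rewrite le_eqVlt; apply/orP; left; apply/eqP.
by field; rewrite !gt_eqF.
Qed.

Lemma scaled_top k : (m < k)%N -> scaled_at A u h k = h `^ (m%:R + al) * A.
Proof. by rewrite /scaled ltnNge => /negbTE ->. Qed.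

(** As theta <= 1, the loss theta^-2 of a time step also covers the loss theta^-1 of a space
    step. *)
Lemma order_step k th : (0 < k <= m)%N -> 0 < th <= 1 ->
  scaled_at A u h k <= (2 / c * th ^- 2) * \sum_(0 <= i < k) scaled_at A u h i +
    (C1 * th `^ al) * \sum_(k.+1 <= i < m.+2) scaled_at A u h i.
Proof.
move=> /andP[k0 km] /[dup] th01 /andP[th0 th1].
have hk : 0 < h ^+ k by rewrite exprn_gt0.
set lo := \sum_(0 <= i < k) _; set hi := \sum_(k.+1 <= i < m.+2) _.
have lo_le i : (i < k)%N -> scaled_at A u h i <= lo.
  by move=> ik; apply: le_bignat_term => //; exact: scaled_pos.
(* The order k + 2 of a time step may exceed m + 1; by the convention of [scaled] its value is then
   that of the last term of the sum. *)
have hi_le i : (k < i)%N -> scaled_at A u h i <= hi.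
  move=> ki; have [im|im] := leqP i m.+1.
    by apply: le_bignat_term; [exact: scaled_pos|rewrite ki].
  rewrite scaled_top ?(ltnW im)// -(@scaled_top m.+1)//.
  by apply: le_bignat_term; [exact: scaled_pos|rewrite ltnS km/=].
have lo0 : 0 <= lo := le_trans (scaled_pos 0) (lo_le 0%N k0).
have hi0 : 0 <= hi := le_trans (scaled_pos k.+1) (hi_le _ (ltnSn k)).
have thal0 : 0 <= th `^ al by exact: powR_ge0.
have C0 : 0 <= C1 by exact: le_trans C1_ge1.
have c2 : 0 <= 2 / c by rewrite divr_ge0// ltW.
have thV : 0 <= th^-1 by rewrite invr_ge0 ltW.
have thV1 : 1 <= th^-1 by rewrite invf_ge1.
have th2 : 0 <= th ^- 2 by rewrite invr_ge0 exprn_ge0// ltW.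
rewrite [leLHS]/scaled km mulrC -ler_pdivlMr//.
apply: ordsup_le.
  by apply: divr_ge0 (ltW hk); apply: addr_ge0; do 2 apply: mulr_ge0 => //.
move=> j s z ss sk cz; rewrite ler_pdivlMr// mulrC.
case: j sk => [|j] sk; last first.
  have := @time_step j s z th ss; rewrite sk => /(_ km cz th01) /le_trans; apply.
  apply: lerD.
    apply: ler_pM => //; rewrite ?mulr_ge0 ?scaled_pos//; last by apply: lo_le; rewrite -sk ltn_add2l ltn_mul2l ltnSn.
    by rewrite ler_wpM2r// ler_pdivlMr// ler_piMr.
  apply: ler_pM => //; rewrite ?scaled_pos//; last by apply: hi_le; exact: leqnSn.
  by rewrite ler_peMl.
case: s ss sk => [|i s] ss; first by rewrite muln0 /= => k0'; rewrite -k0' in k0.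
rewrite muln0 addn0 /= => sk.
have := @space_step i s z th ss; rewrite sk => /(_ km cz th01) /le_trans; apply.
apply: lerD.
  apply: ler_pM; rewrite ?scaled_pos//.
  - exact: mulr_ge0.
  - apply: ler_wpM2l => //.
    by rewrite -exprVn expr2 ler_peMl.
  - by apply: lo_le; rewrite -sk.
apply: ler_pM; rewrite ?scaled_pos//; first exact: mulr_ge0.
by apply: hi_le; exact: ltnSn.
Qed.

End one_function.
End interpolation.

(** * Bounds by the top seminorm and an integral norm, uniform in u and h *)

Section uniform_estimates.
Context {R : realType} {N : nat}.
Variables (Omega : set 'rV[R]_N) (T : R) (m : nat) (al r0 c : R).
Hypotheses (r0_gt0 : 0 < r0) (c_gt0 : 0 < c) (c_le1 : c <= 1).
Hypotheses (al_gt0 : 0 < al) (al_lt1 : al < 1) (N_gt0 : (0 < N)%N) (T_gt0 : 0 < T).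
Hypotheses (oOmega : open Omega) (cone : cone_condition Omega r0 c).
Implicit Types (u : 'rV[R]_N * R -> R) (A B h th : R).

Local Notation Cyl := (cyl Omega T).
Local Notation srt := (sorted (@ole N)).
Local Notation ordsup := (ordsup Omega T).
Local Notation scaled_at := (scaled Omega T m al).
Local Notation hoelder_bounds := (hoelder_bounds Omega T m al).
Local Notation max_scale := (max_scale T r0 c).

Definition admissible u A h :=
  [/\ C_par Omega T m u, 0 <= A, hoelder_bounds A u, 0 < h & h <= max_scale].

Lemma scaled_interpolation : exists2 C : R, 1 <= C & forall u A h, admissible u A h ->
  forall k, scaled_at A u h k <= C * (ordsup u 0 + h `^ (m%:R + al) * A).
Proof.
(* All functions and all scales together, so that the resulting constant depends on neither. *)
pose F := [set a | exists u A h, admissible u A h /\ a = scaled_at A u h].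
have [|d d0|C C1 CH] := @chain_interpolation R m F.
- by move=> _ [u [A [h [[Cu A0 uA h0 hm] ->]]]] k; exact: (scaled_pos A0 uA h0).
- have C1_gt0 : 0 < 10 * N%:R / c by rewrite divr_gt0// mulr_gt0// ltr0n.
  have [th th01 thd] := small_scale C1_gt0 d0 al_gt0.
  exists (2 / c * th ^- 2).
    have /andP[th0 _] := th01.
    by rewrite mulr_ge0 ?divr_ge0 ?(ltW c_gt0)// invr_ge0 exprn_ge0// ltW.
  move=> _ [u [A [h [[Cu A0 uA h0 hm] ->]]]] k km.
  have := order_step r0_gt0 c_gt0 c_le1 al_gt0 al_lt1 N_gt0 oOmega cone
    Cu A0 uA h0 hm km th01.
  move/le_trans; apply; rewrite lerD2l ler_wpM2r// sumr_ge0// => i _.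
  exact: (scaled_pos A0 uA h0).
exists C => // u A h adm k; have [Cu A0 uA h0 hm] := adm.
have Fa : F (scaled_at A u h) by exists u, A, h.
have := CH _ Fa k; have := CH _ Fa 0%N (leq0n _).
rewrite (scaled_top _ _ _ _ _ _ (ltnSn m)).
have S0 : scaled_at A u h 0 = ordsup u 0 by rewrite /scaled expr0 mul1r.
rewrite S0 => _ H.
have [km|km] := leqP k m; first exact: H.
rewrite (scaled_top _ _ _ _ _ _ km); apply: (@le_trans _ _ (1 * (ordsup u 0 + h `^ (m%:R + al) * A))).
  by rewrite mul1r lerDr (ordsup_ge0 A0 uA).
rewrite ler_wpM2r// addr_ge0 ?(ordsup_ge0 A0 uA)// mulr_ge0 ?powR_ge0//.
Qed.

(* [B] is meant to be a Lebesgue norm of [u], in space-time or in space, which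
   is why a lower bound of [|u|] is required at all nearby times. *)
Definition local_mass (K d : R) u B := forall x x' t r a, Cyl (x, t) ->
  (forall z, `|z - x'| <= c * r -> Omega z) -> 0 < r -> r ^+ 2 <= T / 4 -> 0 <= a ->
  (forall y t', `|y - x'| <= c * r -> Cyl (y, t') -> `|t - t'| <= r ^+ 2 ->
     a <= `|u (y, t')|) ->
  a <= K * r `^ (- d) * B.

(** Where |u(x, t)| exceeds D, half of sup |u| plus half of the top seminorm, |u| is at least |u(x,
    t)| - D on a whole box of size theta h, and [local_mass] bounds this difference. The half of sup
    |u| is then absorbed. *)
Lemma scaled_le_norm (K d : R) : 0 <= K -> exists2 C : R, 1 <= C &
  forall u A B h, admissible u A h -> 0 <= B -> local_mass K d u B ->
  forall k, scaled_at A u h k <= C * (h `^ (m%:R + al) * A + h `^ (- d) * B).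
Proof.
move=> K0; have [Ci Ci1 CiH] := scaled_interpolation.
have Ci0 : 0 < Ci by exact: lt_le_trans ltr01 Ci1.
pose C1 := 10 * N%:R / c.
have C1_gt0 : 0 < C1 by rewrite divr_gt0// mulr_gt0// ltr0n.
(* The oscillation on the box has a time part with factor 1 and a space part with factor [C1]; [Ci]
   bounds both a_2 and a_1. Theta makes the total at most 1 / 2 and depends on neither u nor h. *)
have C2_gt0 : 0 < (C1 + 1) * Ci by rewrite mulr_gt0// addr_gt0.
have half0 : 0 < 1 / 2 :> R by rewrite divr_gt0.
have [th th01 thd] := small_scale C2_gt0 half0 al_gt0.
have /andP[th0 th1] := th01.
pose C3 := 1 + 2 * K * th `^ (- d).
have C3_ge1 : 1 <= C3 by rewrite lerDl !mulr_ge0// powR_ge0.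
exists (Ci * (1 + C3)).
  by rewrite -[leLHS]mulr1 ler_pM//; lra.
move=> u A B h adm B0 mass k; have [Cu A0 uA h0 hm] := adm.
have [h1 hr hT] := le_max_scale hm.
set top := h `^ (m%:R + al) * A.
have top0 : 0 <= top by rewrite mulr_ge0// powR_ge0.
have S0 : 0 <= ordsup u 0 by exact: (ordsup_ge0 A0 uA).
have hB0 : 0 <= h `^ (- d) * B by rewrite mulr_ge0// powR_ge0.
have rp : 0 < th * h by rewrite mulr_gt0.
have rh : th * h <= h by rewrite ler_piMl// ltW.
have r_le : th * h <= r0.
  by have := ler_wpM2r (ltW r0_gt0) c_le1; have := r0_gt0; lra.
have rT : (th * h) ^+ 2 <= T / 4.
  have r1 := le_trans rh h1.
  apply: le_trans hT; apply: le_trans rh; rewrite expr2 ler_piMl ?(ltW rp)//.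
have key : ordsup u 0 <= 1 / 2 * (ordsup u 0 + top) + K * (th `^ (- d) * h `^ (- d)) * B.
  set D := 1 / 2 * (ordsup u 0 + top).
  have D0 : 0 <= D by rewrite mulr_ge0 ?divr_ge0// addr_ge0.
  apply: ordsup_le.
    by rewrite addr_ge0// !mulr_ge0// powR_ge0.
  move=> j s [x t] ss /eqP; rewrite addn_eq0 muln_eq0 /= => /andP[/nilP -> /eqP ->] cx.
  rewrite /jderiv /=.
  have [Ox tT] := cx.
  have [x' x'x box] := inner_box r0_gt0 cone Ox (introT andP (conj rp r_le)).
  rewrite -lerBlDl; have [neg|pos] := leP (`|u (x, t)| - D) 0.
    by apply: le_trans neg _; rewrite !mulr_ge0// powR_ge0.
  have := mass x x' t (th * h) _ cx box rp rT (ltW pos); rewrite powRM ?(ltW th0) ?(ltW h0)//.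
  apply=> y t' yx' cy tt; rewrite lerBlDr -lerBlDl.
  apply: le_trans (lerB_dist _ _) _.
  have Oy : Omega y by case: cy.
  have cxt' : Cyl (x, t') by split=> //; case: cy.
  have xy : `|x - y| <= 2 * (th * h).
    have -> : x - y = - ((y - x') + (x' - x)) by apply/rowP => i; rewrite !mxE; ring.
    rewrite normrN; apply: le_trans (ler_normD _ _) _.
    have : c * (th * h) <= 1 * (th * h) by rewrite ler_wpM2r// ltW.
    by lra.
  (* From (x, t) to (y, t') through (x, t'), which lies in the cylinder although (y, t) was not
     examined. *)
  have o1 := @osc_t_al _ _ _ _ _ _ al_gt0 al_lt1 _ _ _ Cu A0 uA h0
    0 [::] x t t' th isT (leq0n _) cx cxt' th01 tt.
  have o2 := @osc_x_al _ _ _ _ _ _ _ _ r0_gt0 c_gt0 c_le1 al_gt0 al_lt1 N_gt0 oOmega cone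
    _ _ _ Cu A0 uA h0 hm 0 [::] x y t' th isT (leq0n _) cxt' cy th01 xy.
  rewrite /= !expr0 !mul1r /jderiv /= in o1 o2.
  rewrite -(subrK (u (x, t')) (u (x, t))) -addrA.
  apply: le_trans (ler_normD _ _) _; apply: le_trans (lerD o1 o2) _.
  have tal0 : 0 <= th `^ al by exact: powR_ge0.
  have s2 := CiH _ _ _ adm 2%N; have s1 := CiH _ _ _ adm 1%N.
  have C1tal : 0 <= C1 * th `^ al by rewrite mulr_ge0// ltW.
  apply: le_trans (lerD (ler_wpM2l tal0 s2) (ler_wpM2l C1tal s1)) _.
  rewrite -/top /D; have : 0 <= ordsup u 0 + top by rewrite addr_ge0.
  move: (ordsup u 0 + top) => q q0.
  have -> : th `^ al * (Ci * q) + C1 * th `^ al * (Ci * q) = (C1 + 1) * Ci * th `^ al * q by ring.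
  by rewrite ler_wpM2r.
have S0le : ordsup u 0 <= C3 * (top + h `^ (- d) * B).
  have : ordsup u 0 <= top + 2 * K * th `^ (- d) * (h `^ (- d) * B).
    by move: key; move: (h `^ (- d)) (th `^ (- d)) => p q; lra.
  move/le_trans; apply; rewrite /C3 mulrDl mul1r mulrDr.
  have : 0 <= 2 * K * th `^ (- d) * top by rewrite !mulr_ge0// powR_ge0.
  by move: hB0; move: (h `^ (- d) * B) => q q0; lra.
apply: le_trans (CiH _ _ _ adm k) _; rewrite -mulrA ler_wpM2l ?(ltW Ci0)//.
rewrite -/top mulrDl mul1r addrC; apply: lerD => //.
by rewrite lerDl.
Qed.

Section hoelder_seminorms.
Variables (u : 'rV[R]_N * R -> R) (A h G : R).
Hypotheses (adm : admissible u A h) (G_ge : forall k, scaled_at A u h k <= G).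

Let G_ge0 : 0 <= G.
Proof.
have [Cu A0 uA h0 hm] := adm.
by apply: le_trans (G_ge 0); exact: (scaled_pos A0 uA h0).
Qed.

Lemma jderiv_scaled_le j s z : srt s -> (size s + 2 * j <= m)%N -> Cyl z ->
  `|jderiv u j s z| <= h `^ (- (size s + 2 * j)%:R) * G.
Proof.
move=> ss sm cz; have [Cu A0 uA h0 hm] := adm.
apply: le_trans (jderiv_le_ordsup A0 uA ss sm cz) _.
rewrite powRN powR_mulrn ?(ltW h0)// mulrC ler_pdivlMr ?exprn_gt0// mulrC.
by have := G_ge (size s + 2 * j); rewrite /scaled sm.
Qed.

(** With theta = |x - y| / h: for theta <= 1 this is [osc_x], and for theta > 1 the bound 2 sup
    suffices since theta^b >= 1. The exponent b may reach [xexp] itself, which the weaker [osc_x_al]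
    would not give. *)
Lemma hoelder_x_le j s x y t (b : R) : srt s -> (size s + 2 * j <= m)%N ->
  Cyl (x, t) -> Cyl (y, t) -> 0 < b -> b <= xexp m al (size s + 2 * j) ->
  `|jderiv u j s (x, t) - jderiv u j s (y, t)| <=
    (10 * N%:R / c + 2) * (h `^ (- ((size s + 2 * j)%:R + b)) * G) * `|x - y| `^ b.
Proof.
move=> ss sm cx cy b0 bx; have [Cu A0 uA h0 hm] := adm.
set k := (size s + 2 * j)%N in sm bx *.
have C1_gt0 : 0 < 10 * N%:R / c by rewrite divr_gt0// mulr_gt0// ltr0n.
have [->|xy] := eqVneq x y.
  by rewrite !subrr !normr0 powR0 ?mulr0// gt_eqF.
have d0 : 0 < `|x - y| by rewrite normr_gt0 subr_eq0.
pose th := `|x - y| / h.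
have th0 : 0 < th by rewrite divr_gt0.
have thh : th * h = `|x - y| by rewrite divfK// gt_eqF.
have -> : h `^ (- (k%:R + b)) = h `^ (- k%:R) * h `^ (- b) by rewrite opprD powRD_gt0.
have E : `|x - y| `^ b = th `^ b * h `^ b by rewrite -thh powRM// ltW.
rewrite E; have hb : h `^ (- b) * h `^ b = 1.
  by rewrite -powRD_gt0// addNr powRr0.
have -> : (10 * N%:R / c + 2) * (h `^ (- k%:R) * h `^ (- b) * G) * (th `^ b * h `^ b) =
  h `^ (- k%:R) * ((10 * N%:R / c + 2) * th `^ b * G).
  by rewrite -[RHS]mulr1 -[X in _ = _ * X]hb; ring.
rewrite powRN powR_mulrn ?(ltW h0)// mulrC ler_pdivlMr ?exprn_gt0// mulrC.
have [_ hr _] := le_max_scale hm.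
have [th1|th1] := leP th 1.
  have th01 : 0 < th <= 1 by rewrite th0.
  have xyt : `|x - y| <= 2 * (th * h) by rewrite thh; lra.
  have := osc_x r0_gt0 c_gt0 c_le1 al_gt0 al_lt1 N_gt0 oOmega cone Cu A0 uA
    ss sm cx cy h0 th01 hr xyt.
  move/le_trans; apply; rewrite -/k.
  apply: ler_pM (G_ge _); first by rewrite mulr_ge0 ?powR_ge0 ?(ltW C1_gt0).
    exact: (scaled_pos A0 uA h0).
  apply: ler_pM; rewrite ?powR_ge0 ?(ltW C1_gt0) ?lerDl//.
  exact: ger_powR.
have hk : 0 <= h ^+ k by rewrite exprn_ge0// ltW.
apply: le_trans (ler_wpM2l hk (ler_normB _ _)) _.
have Gk : h ^+ k * ordsup u k <= G by have := G_ge k; rewrite /scaled sm.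
have := ler_wpM2l hk (jderiv_le_ordsup A0 uA ss sm cx).
have := ler_wpM2l hk (jderiv_le_ordsup A0 uA ss sm cy).
have th1b : 1 <= th `^ b by rewrite -(powRr0 th) ler_powR// ltW.
have : 2 * G <= (10 * N%:R / c + 2) * th `^ b * G.
  rewrite ler_wpM2r// -[leLHS]mulr1 ler_pM//; lra.
by rewrite -/k; lra.
Qed.

(** As in space, with theta = |t - t'|^(1/2) / h, so that the exponent b in t becomes 2 b in
    theta. *)
Lemma hoelder_t_le j s x t t' (b : R) : srt s -> (size s + 2 * j <= m)%N ->
  Cyl (x, t) -> Cyl (x, t') -> 0 < b -> 2 * b <= texp m al (size s + 2 * j) ->
  `|jderiv u j s (x, t) - jderiv u j s (x, t')| <=
    2 * (h `^ (- ((size s + 2 * j)%:R + 2 * b)) * G) * `|t - t'| `^ b.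
Proof.
move=> ss sm cx cx' b0 bx; have [Cu A0 uA h0 hm] := adm.
set k := (size s + 2 * j)%N in sm bx *.
have [->|tt] := eqVneq t t'.
  by rewrite !subrr !normr0 powR0 ?mulr0// gt_eqF.
have d0 : 0 < `|t - t'| by rewrite normr_gt0 subr_eq0.
pose q := `|t - t'| `^ 2^-1.
have q0 : 0 < q by exact: powR_gt0.
have qq : q ^+ 2 = `|t - t'|.
  by rewrite -powR_mulrn ?(ltW q0)// -powRrM mulVf// powRr1.
pose th := q / h.
have th0 : 0 < th by rewrite divr_gt0.
have thh : th * h = q by rewrite divfK// gt_eqF.
have -> : h `^ (- (k%:R + 2 * b)) = h `^ (- k%:R) * h `^ (- (2 * b)) by rewrite opprD powRD_gt0.
have E : `|t - t'| `^ b = th `^ (2 * b) * h `^ (2 * b).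
  by rewrite -powRM ?(ltW th0) ?(ltW h0)// thh powRrM powR_mulrn ?(ltW q0)// qq.
rewrite E; have hb : h `^ (- (2 * b)) * h `^ (2 * b) = 1.
  by rewrite -powRD_gt0// addNr powRr0.
have -> : 2 * (h `^ (- k%:R) * h `^ (- (2 * b)) * G) * (th `^ (2 * b) * h `^ (2 * b)) =
  h `^ (- k%:R) * (2 * th `^ (2 * b) * G).
  move: hb; move: (h `^ _) (h `^ _) (th `^ _) (h `^ _) => hk hb' thb hb hbE.
  by rewrite -[RHS]mulr1 -[X in _ = _ * X]hbE; ring.
rewrite powRN powR_mulrn ?(ltW h0)// mulrC ler_pdivlMr ?exprn_gt0// mulrC.
have [th1|th1] := leP th 1.
  have th01 : 0 < th <= 1 by rewrite th0.
  have ttt : `|t - t'| <= (th * h) ^+ 2 by rewrite thh qq.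
  have := osc_t al_gt0 Cu A0 uA ss sm cx cx' h0 th01 ttt.
  move/le_trans; apply; rewrite -/k.
  apply: ler_pM (G_ge _); rewrite ?powR_ge0 ?(scaled_pos A0 uA h0)//.
  apply: (@le_trans _ _ (th `^ (2 * b))); first exact: ger_powR.
  by rewrite ler_peMl ?powR_ge0// ler1n.
have hk : 0 <= h ^+ k by rewrite exprn_ge0// ltW.
apply: le_trans (ler_wpM2l hk (ler_normB _ _)) _.
have Gk : h ^+ k * ordsup u k <= G by have := G_ge k; rewrite /scaled sm.
have := ler_wpM2l hk (jderiv_le_ordsup A0 uA ss sm cx).
have := ler_wpM2l hk (jderiv_le_ordsup A0 uA ss sm cx').
have th1b : 1 <= th `^ (2 * b) by rewrite -[leLHS](powRr0 th) ler_powR ?(ltW th1)// mulr_ge0// ltW.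
have : 2 * G <= 2 * th `^ (2 * b) * G.
  by rewrite ler_wpM2r// ler_peMr.
by rewrite -/k; lra.
Qed.

End hoelder_seminorms.
End uniform_estimates.

(** * Optimisation of the scale *)

Section optimal_scale.
Context {R : realType}.
Implicit Types A B X K h d l om : R.

(** The best h balances h^l2 A against h^(-d) B. When it exceeds [h0], the bound X <= K A takes
    over. *)
Lemma optimal_scale (K h0 l1 l2 d : R) : 0 <= K -> 0 < h0 -> h0 <= 1 -> l1 < l2 ->
  0 < l2 + d ->
  exists2 C, 0 < C & forall X A B, 0 <= A -> 0 <= B -> X <= K * A ->
    (forall h, 0 < h <= h0 -> X <= K * (h `^ (- l1) * (h `^ l2 * A + h `^ (- d) * B))) ->
    X <= C * A `^ ((l1 + d) / (l2 + d)) * B `^ (1 - (l1 + d) / (l2 + d)).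
Proof.
move=> K0 h00 h01 l12 e0; set e := l2 + d in e0 *; set om := (l1 + d) / e.
have omE : 1 - om = (l2 - l1) / e by rewrite /om /e; field; rewrite gt_eqF.
have om1 : 0 < 1 - om by rewrite omE divr_gt0// subr_gt0.
have hp : 0 < h0 `^ (- (l2 - l1)) by exact: powR_gt0.
exists (1 + 2 * K + K * h0 `^ (- (l2 - l1))).
  by rewrite -addrA ltr_pwDl// addr_ge0 ?mulr_ge0// ltW.
move=> X A B A0 B0 XA Xh.
have [A00|An0] := eqVneq A 0.
  rewrite A00 mulr0 in XA; apply: le_trans XA _.
  by rewrite !mulr_ge0 ?powR_ge0// !addr_ge0// !mulr_ge0// ltW.
have Ap : 0 < A by rewrite lt_neqAle eq_sym An0.
have [B00|Bn0] := eqVneq B 0.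
  (* For B = 0 nothing balances A; letting h tend to 0 shows that X cannot be positive. *)
  rewrite B00 powR0 ?mulr0 ?gt_eqF//; rewrite leNgt; apply/negP => X0.
  have KA0 : 0 < 1 + K * A by rewrite ltr_pwDl// mulr_ge0.
  have X2 : 0 < X / 2 by rewrite divr_gt0.
  have l0 : 0 < l2 - l1 by rewrite subr_gt0.
  have [th /andP[th0 th1] thX] := small_scale KA0 X2 l0.
  have h1 : 0 < th * h0 by rewrite mulr_gt0.
  have hle : th * h0 <= h0 by rewrite ler_piMl// ltW.
  have := Xh (th * h0); rewrite h1 hle => /(_ isT).
  rewrite B00 mulr0 addr0 [_ * (_ * A)]mulrA -powRD_gt0// [- l1 + l2]addrC powRM ?(ltW th0) ?(ltW h00)//.
  have hp1 : h0 `^ (l2 - l1) <= 1.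
    by rewrite -[leRHS](powRr0 h0); apply: ger_powR; [rewrite h00|exact: ltW].
  have tp := powR_ge0 th (l2 - l1).
  have : K * (th `^ (l2 - l1) * h0 `^ (l2 - l1) * A) <= (1 + K * A) * th `^ (l2 - l1).
    rewrite [leRHS]mulrDl mul1r ler_wpDl//.
    rewrite -[leRHS]mulrA ler_wpM2l// [leRHS]mulrC ler_wpM2r ?(ltW Ap)//.
    by rewrite ler_piMr.
  by move: (K * (_ * A)) (_ * th `^ _) thX => a b; lra.
have Bp : 0 < B by rewrite lt_neqAle eq_sym Bn0.
have q0 : 0 < B / A by rewrite divr_gt0.
have AE : A = A `^ om * A `^ (1 - om) by rewrite -powRD_gt0// addrCA subrr addr0 powRr1.
have BE : B `^ (1 - om) = (B / A) `^ (1 - om) * A `^ (1 - om).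
  by rewrite -powRM ?(ltW q0) ?(ltW Ap)// divfK.
have E2 : A `^ om * B `^ (1 - om) = (B / A) `^ (1 - om) * A.
  by rewrite BE mulrCA -AE.
have omp : 0 <= A `^ om * B `^ (1 - om) by rewrite mulr_ge0// powR_ge0.
(* The balance h^(l2 + d) = B / A. *)
pose h := (B / A) `^ e^-1.
have hgt0 : 0 < h by exact: powR_gt0.
have he : h `^ e = B / A by rewrite -powRrM mulVf ?gt_eqF// powRr1// ltW.
rewrite -mulrA; have [hh|hh] := leP h h0.
  have := Xh h; rewrite hgt0 hh => /(_ isT) H.
  apply: (@le_trans _ _ (2 * K * (A `^ om * B `^ (1 - om)))); last first.
    rewrite ler_wpM2r//; have := mulr_ge0 K0 (ltW hp); lra.
  apply: le_trans H _; rewrite le_eqVlt; apply/orP; left; apply/eqP.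
  have -> : h `^ (- d) * B = h `^ l2 * A.
    have -> : B = h `^ e * A by rewrite he divfK.
    by rewrite mulrA -powRD_gt0//; congr (h `^ _ * _); rewrite /e; ring.
  have -> : h `^ (- l1) * (h `^ l2 * A + h `^ l2 * A) = 2 * (h `^ (l2 - l1) * A).
    by rewrite powRD_gt0//; ring.
  have -> : h `^ (l2 - l1) = (B / A) `^ (1 - om).
    by rewrite /h -powRrM [e^-1 * _]mulrC omE.
  by rewrite [A `^ om * _]E2; ring.
(* Here (B / A)^(1 - om) = h^(l2 - l1) is at least h0^(l2 - l1), so A itself is bounded by the
   interpolated quantity. *)
apply: (@le_trans _ _ (K * h0 `^ (- (l2 - l1)) * (A `^ om * B `^ (1 - om)))); last first.
  by rewrite ler_wpM2r//; lra.
apply: le_trans XA _; rewrite -mulrA ler_wpM2l//.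
rewrite [leLHS]AE mulrCA ler_wpM2l ?powR_ge0// BE mulrA.
rewrite -[leLHS]mul1r ler_wpM2r ?powR_ge0//.
rewrite powRN mulrC ler_pdivlMr ?powR_gt0// mul1r.
have -> : (B / A) `^ (1 - om) = h `^ (l2 - l1) by rewrite /h -powRrM [e^-1 * _]mulrC omE.
by apply: ge0_ler_powR; rewrite ?nnegrE ?(ltW h00) ?(ltW hgt0) ?(ltW hh)// subr_ge0 ltW.
Qed.

End optimal_scale.

(** * All the terms of the norm of order l1 *)

Section order_bounds.
Context {R : realType} {N : nat}.
Variables (Omega : set 'rV[R]_N) (T : R).
Implicit Types (u : 'rV[R]_N * R -> R) (A B h th l X : R).

Local Notation Cyl := (cyl Omega T).
Local Notation srt := (sorted (@ole N)).

(* The meaning of [par_norm l u <= X] for each term of the norm, on the open cylinder. *)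
Definition order_bounds l u X := let m := Num.truncn l in
 [/\ forall j s z, srt s -> (size s + 2 * j <= m)%N -> Cyl z -> `|jderiv u j s z| <= X,
   l \isn't a Num.int -> forall j s x y t, srt s ->
     (size s + 2 * j <= m <= (size s + 2 * j).+1)%N -> Cyl (x, t) -> Cyl (y, t) ->
     `|jderiv u j s (x, t) - jderiv u j s (y, t)| <= X * enorm (x - y) `^ (l - m%:R) &
   l \isn't a Num.int -> forall j s x t t', srt s ->
     (size s + 2 * j <= m <= (size s + 2 * j).+1)%N -> Cyl (x, t) -> Cyl (x, t') ->
     `|jderiv u j s (x, t) - jderiv u j s (x, t')| <=
       X * `|t - t'| `^ (((m - (size s + 2 * j))%:R + (l - m%:R)) / 2)].

Lemma order_bounds_hoelder l u A : l \isn't a Num.int -> order_bounds l u A ->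
  hoelder_bounds Omega T (Num.truncn l) (l - (Num.truncn l)%:R) A u.
Proof.
move=> li [b1 b2 b3]; split=> // [j s x y t ss sm cx cy|]; last exact: b3.
by apply: b2 => //; rewrite sm leqnn leqnSn.
Qed.

(** Every term is an inequality v <= X q with q >= 0. The scale can therefore be optimised in each
    inequality separately, even if no single X of the family is best. *)
Lemma order_bounds_inf l u (F : set R) X0 : (forall X, F X -> order_bounds l u X) ->
  (forall v q : R, 0 <= q -> (forall X, F X -> v <= X * q) -> v <= X0 * q) ->
  order_bounds l u X0.
Proof.
move=> OF H; split=> [j s z ss sm cz|li j s x y t ss sm cx cy|li j s x t t' ss sm cx cx'].
- rewrite -[leRHS]mulr1; apply: H => // X /OF[b1 _ _]; rewrite mulr1; exact: b1.
- by apply: H => [|X /OF[_ b2 _]]; [exact: powR_ge0|exact: b2].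
- by apply: H => [|X /OF[_ _ b3]]; [exact: powR_ge0|exact: b3].
Qed.

Lemma order_bounds_le l u X X' : X <= X' -> order_bounds l u X -> order_bounds l u X'.
Proof.
move=> XX OX; apply: (@order_bounds_inf l u [set X]) => [_ ->//|v q q0 /(_ X erefl) /le_trans].
by apply; rewrite ler_wpM2r.
Qed.

Lemma frac_part_itv l : 0 < l -> l \isn't a Num.int ->
  0 < l - (Num.truncn l)%:R /\ l - (Num.truncn l)%:R < 1.
Proof.
move=> l0 li; have /andP[h1 h2] := truncn_itv (ltW l0).
split; last by rewrite ltrBlDl -natr1 in h2 *.
rewrite subr_gt0 lt_neqAle h1 andbT; apply: contra li => /eqP <-.
exact: intr_nat.
Qed.

Variables (r0 c l1 l2 : R).
Hypotheses (r0_gt0 : 0 < r0) (c_gt0 : 0 < c) (c_le1 : c <= 1).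
Hypotheses (N_gt0 : (0 < N)%N) (T_gt0 : 0 < T).
Hypotheses (l1_gt0 : 0 < l1) (l1_lt : l1 < l2) (l2_nint : l2 \isn't a Num.int).
Hypotheses (oOmega : open Omega) (cone : cone_condition Omega r0 c).
Let m := Num.truncn l2.
Let al := l2 - m%:R.

(** Each term of the norm carries a power h^(-k) with k <= l1, and h <= 1 makes h^(-l1) the
    largest. *)
Lemma scaled_order_bounds u A h G : admissible Omega T m al r0 c u A h ->
  (forall k, scaled Omega T m al A u h k <= G) ->
  order_bounds l1 u ((10 * N%:R / c + 2) * (h `^ (- l1) * G)).
Proof.
move=> adm Gk.
have l2_gt0 : 0 < l2 by exact: lt_trans l1_lt.
have [al0 al1] := frac_part_itv l2_gt0 l2_nint; rewrite -/m -/al in al0 al1.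
have [Cu A0 uA h0 hm] := adm.
have [h1 _ _] := le_max_scale hm.
have h01 : 0 < h <= 1 by rewrite h0.
have G0 : 0 <= G by apply: le_trans (Gk 0); exact: (scaled_pos A0 uA h0).
have C1 : 0 <= 10 * N%:R / c by rewrite divr_ge0 ?mulr_ge0// ltW.
have hle k : k <= l1 -> h `^ (- k) * G <= h `^ (- l1) * G.
  by move=> kl; rewrite ler_wpM2r//; apply: ger_powR => //; rewrite lerN2.
have hG0 : 0 <= h `^ (- l1) * G by rewrite mulr_ge0// powR_ge0.
have /andP[m1l l1m1] := truncn_itv (ltW l1_gt0).
set m1 := Num.truncn l1 in m1l l1m1.
have m1m : (m1 <= m)%N by apply: le_truncn; exact: ltW.
have e1 : al = l2 - m%:R by [].
rewrite /order_bounds -/m1; split=> [j s z ss sm cz|l1i j s x y t ss|l1i j s x t t' ss].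
- have sm' := leq_trans sm m1m.
  apply: le_trans (jderiv_scaled_le adm Gk ss sm' cz) _.
  apply: (@le_trans _ _ (h `^ (- l1) * G)).
    by apply: hle; apply: le_trans m1l; rewrite ler_nat.
  by rewrite ler_peMl//; lra.
- move=> /andP[sm sm1] cx cy.
  have [a0 a1] := frac_part_itv l1_gt0 l1i; rewrite -/m1 in a0 a1.
  have sm' := leq_trans sm m1m.
  apply: le_trans (hoelder_x_le r0_gt0 c_gt0 c_le1 al0 al1 N_gt0 oOmega cone adm Gk
    ss sm' cx cy a0 _) _.
    (* At order m the exponent must not exceed al. Then l1 and l2 have the same integer part, and l1
       < l2 compares the fractional parts. *)
    rewrite /xexp; case: ltnP => [_|ms]; first exact: ltW.
    have -> : m1 = m by apply/eqP; rewrite eqn_leq m1m (leq_trans ms).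
    by rewrite e1 lerD2r ltW.
  apply: ler_pM; rewrite ?powR_ge0 ?mulr_ge0 ?powR_ge0 ?addr_ge0//.
    apply: ler_wpM2l; first by rewrite addr_ge0.
    apply: hle; have : (size s + 2 * j)%:R <= m1%:R :> R by rewrite ler_nat.
    by lra.
  by apply: ge0_ler_powR; rewrite ?nnegrE ?(ltW a0) ?enorm_ge0 ?norm_le_enorm.
- move=> /andP[sm sm1] cx cx'.
  have [a0 a1] := frac_part_itv l1_gt0 l1i; rewrite -/m1 in a0 a1.
  have sm' := leq_trans sm m1m.
  set k := (size s + 2 * j)%N in sm sm1 sm' *.
  have b0 : 0 < ((m1 - k)%:R + (l1 - m1%:R)) / 2.
    by rewrite divr_gt0// ltr_wpDl.
  have b2 : 2 * (((m1 - k)%:R + (l1 - m1%:R)) / 2) = l1 - k%:R.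
    by rewrite natrB//; field.
  have : 2 * (((m1 - k)%:R + (l1 - m1%:R)) / 2) <= texp m al k.
    rewrite b2 /texp; case: ifPn => km.
      have : m1%:R <= k%:R + 1 :> R by rewrite natr1 ler_nat.
      by lra.
    by rewrite natrB// e1 [leRHS]addrC subrKA lerD2r ltW.
  move=> /(hoelder_t_le al0 adm Gk ss sm' cx cx' b0) /le_trans; apply.
  rewrite ler_wpM2r ?powR_ge0//.
  apply: (@le_trans _ _ (2 * (h `^ (- l1) * G))).
    by rewrite ler_wpM2l// -/k b2 addrC subrK.
  by rewrite ler_wpM2r//; lra.
Qed.

Lemma order_bounds_interpolation (K d : R) : 0 <= K -> 0 <= d ->
  exists2 C : R, 0 < C & forall u A B, C_par Omega T m u -> 0 <= A -> 0 <= B ->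
    order_bounds l2 u A -> local_mass Omega T c K d u B ->
    order_bounds l1 u (C * A `^ ((l1 + d) / (l2 + d)) * B `^ (1 - (l1 + d) / (l2 + d))).
Proof.
move=> K0 d0.
have l2_gt0 : 0 < l2 by exact: lt_trans l1_lt.
have [al0 al1] := frac_part_itv l2_gt0 l2_nint; rewrite -/m -/al in al0 al1.
have mal : m%:R + al = l2 by rewrite /al addrCA subrr addr0.
have [C1 C11 H1] := scaled_interpolation T m r0_gt0 c_gt0 c_le1 al0 al1 N_gt0 oOmega cone.
have [C2 C21 H2] := scaled_le_norm T m r0_gt0 c_gt0 c_le1 al0 al1 N_gt0 oOmega cone d K0.
have h0 := max_scale_gt0 r0_gt0 c_gt0 T_gt0.
set h_max := max_scale T r0 c in h0.
have h01 : h_max <= 1 by case: (le_max_scale (lexx h_max)).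
pose Q := 10 * N%:R / c + 2.
have Cx : 0 <= Q by rewrite addr_ge0// divr_ge0 ?mulr_ge0// ltW.
have hm0 := powR_ge0 h_max (- l1).
have C20 : 0 <= C2 by exact: le_trans C21.
have C10 : 0 <= C1 by exact: le_trans C11.
(* One constant for both hypotheses of [optimal_scale]: [C2] serves every admissible h, and the
   other summand the bound by A alone, obtained at [h_max] from sup |u| <= A. *)
pose K1 := Q * (C2 + h_max `^ (- l1) * (2 * C1)).
have K10 : 0 <= K1 by rewrite mulr_ge0// addr_ge0// !mulr_ge0.
have e0 : 0 < l2 + d by rewrite ltr_pwDl.
have [C C0 CH] := optimal_scale K10 h0 h01 l1_lt e0.
exists C => // u A B Cu A0 B0 bA mass.
have uA := order_bounds_hoelder l2_nint bA; rewrite -/m -/al in uA.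
have adm h : 0 < h <= h_max -> admissible Omega T m al r0 c u A h by case/andP.
have S0A : ordsup Omega T u 0 <= A.
  apply: ordsup_le => // j s z ss sj cz.
  by have [b1 _ _] := bA; apply: b1 => //; rewrite sj.
have OA : order_bounds l1 u (K1 * A).
  have hh : 0 < h_max <= h_max by rewrite h0 lexx.
  have := scaled_order_bounds (adm _ hh) (H1 _ _ _ (adm _ hh)).
  apply: order_bounds_le.
  rewrite -/Q /K1 -[leRHS]mulrA ler_wpM2l// mulrDl ler_wpDl ?mulr_ge0// -[leRHS]mulrA ler_wpM2l// -[leRHS]mulrA mulrCA ler_wpM2l//.
  have : h_max `^ (m%:R + al) * A <= 1 * A.
    rewrite ler_wpM2r// mal -[leRHS](powRr0 h_max).
    by apply: ger_powR; [rewrite h0|exact: ltW].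
  by lra.
have Oh h : 0 < h <= h_max ->
    order_bounds l1 u (K1 * (h `^ (- l1) * (h `^ l2 * A + h `^ (- d) * B))).
  move=> hh; have /andP[hp _] := hh.
  have := scaled_order_bounds (adm _ hh) (H2 _ _ _ _ (adm _ hh) B0 mass).
  apply: order_bounds_le; rewrite mal -/Q /K1 -[leRHS]mulrA ler_wpM2l// mulrCA.
  rewrite ler_wpM2r ?lerDl ?mulr_ge0// ?addr_ge0 ?mulr_ge0// powR_ge0//.
pose F X := X = K1 * A \/ exists2 h, 0 < h <= h_max &
  X = K1 * (h `^ (- l1) * (h `^ l2 * A + h `^ (- d) * B)).
have OF X : F X -> order_bounds l1 u X by move=> [->//|[h hh ->]]; exact: Oh.
apply: (order_bounds_inf OF) => v q q0 vF.
have [q00|qn0] := eqVneq q 0.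
  by have := vF (K1 * A); rewrite q00 !mulr0; apply; left.
have qp : 0 < q by rewrite lt_neqAle eq_sym qn0.
rewrite -ler_pdivrMr//; apply: CH => //.
  by rewrite ler_pdivrMr//; apply: vF; left.
by move=> h hh; rewrite ler_pdivrMr//; apply: vF; right; exists h.
Qed.

End order_bounds.

(** * Lebesgue norms *)

Section lower_bound.
Context d (T : measurableType d) (R : realType).
Local Open Scope ereal_scope.

(** Chebyshev's inequality. *)
Lemma Lnorm_ge (mu : {measure set T -> \bar R}) (E : set T) (f : T -> R) (p a : R) :
  measurable_fun setT f -> measurable E -> (0 < p)%R -> (0 <= a)%R -> (forall x, E x -> a <= `|f x|)%R ->
  a%:E * mu E `^ p^-1 <= 'N[mu]_p%:E[EFin \o f].
Proof.
move=> mf mE p0 a0 af; rewrite unlock.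
have p'0 : (0 <= p^-1)%R by rewrite invr_ge0 ltW.
have -> : a%:E * mu E `^ p^-1 = ((a `^ p)%:E * mu E) `^ p^-1.
  rewrite poweRM ?lee_fin ?powR_ge0// poweR_EFin; congr (_%:E * _).
  by rewrite -powRrM mulfV ?gt_eqF// powRr1.
apply: gt0_ler_poweR => //.
- by rewrite in_itv /= leey andbT mule_ge0// lee_fin powR_ge0.
- by rewrite in_itv /= leey andbT integral_ge0// => x _; exact: poweR_ge0.
have mfp : measurable_fun setT (fun x => `|(EFin \o f) x| `^ p).
  apply/measurable_EFinP.
  by apply: (measurableT_comp (measurable_powR p)); exact: measurableT_comp.
apply: le_trans (_ : \int[mu]_(x in E) `|(EFin \o f) x| `^ p <= _).
  rewrite -(@integral_cst _ _ _ mu E mE); apply: ge0_le_integral => //.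
  - by move=> x _; rewrite lee_fin powR_ge0.
  - exact: measurable_funTS.
  - move=> x Ex; rewrite /= lee_fin.
    by apply: ge0_ler_powR; rewrite ?nnegrE//; [exact: ltW|exact: af].
by apply: ge0_subset_integral => // x _; exact: poweR_ge0.
Qed.

End lower_bound.

Section boxes.
Context {R : realType}.
Local Notation mR := (measurableTypeR R).
Local Open Scope ereal_scope.

Definition tuple_box n (v : 'I_n -> R) (r : R) : set (n.-tuple mR) :=
  [set x | forall i, (`|tnth x i - v i| <= r)%R].

Lemma measurable_tuple_box n (v : 'I_n -> R) r : measurable (tuple_box v r).
Proof.
have -> : tuple_box v r = \bigcap_(i in [set: 'I_n])
    ((fun x : n.-tuple mR => tnth x i) @^-1` `[v i - r, v i + r]%classic)%R.
  apply/seteqP; split=> x /= H i; first by move=> _; rewrite /= in_itv /= -ler_distl H.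
  by have := H i I; rewrite /= in_itv /= -ler_distl.
apply: fin_bigcap_measurable => // i _.
rewrite -[X in measurable X]setTI; apply: (@measurable_tnth _ mR) => //.
Qed.

Lemma leb_tuple_box n (v : 'I_n -> R) r : (0 < r)%R ->
  leb n (tuple_box v r) = (((2 * r) ^+ n)%R)%:E.
Proof.
move=> r0; elim: n v => [|n IH] v.
  rewrite /leb /= diracE mem_set ?expr0//= => i; by case: i.
rewrite /= /lebS /pushforward.
have -> : cons_pair (n:=n) @^-1` tuple_box v r =
    `[v ord0 - r, v ord0 + r]%classic%R `*` tuple_box (fun i => v (lift ord0 i)) r.
  apply/seteqP; split=> -[a x] /= H.
    split=> [|i] /=; first by rewrite in_itv /= -ler_distl; exact: (H ord0).
    by have := H (lift ord0 i); rewrite tnthS.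
  move=> i; have [h1 h2] := H; have [j|] := unliftP ord0 i; last first.
    by move=> ->; move: h1; rewrite /= in_itv /= -ler_distl.
  by move=> ->; rewrite tnthS; exact: h2.
rewrite product_measure1E; [|exact: measurable_itv|exact: measurable_tuple_box].
rewrite IH exprS EFinM; congr (_ * _).
apply: etrans (lebesgue_measure_itv `[(v ord0 - r)%R, (v ord0 + r)%R]) _.
rewrite /= lte_fin ifT; last by lra.
by rewrite -EFinB; congr (_%:E); lra.
Qed.

End boxes.

Section lebesgue_local_mass.
Context {R : realType} {N : nat}.
Variables (Omega : set 'rV[R]_N) (T p c : R).
Hypotheses (c_gt0 : 0 < c) (p_gt0 : 0 < p).
Implicit Type u : 'rV[R]_N * R -> R.

Lemma row_box (x' : 'rV[R]_N) (x : N.-tuple (measurableTypeR R)) r : 0 <= r ->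
  tuple_box (fun i => x' 0 i) r x -> `|row_of_tuple x - x'| <= r.
Proof. by move=> r0 H; apply/rV_norm_leP => // i; rewrite !mxE. Qed.

(* [a] is bounded by [B] divided by the [p]-th root of the volume of a box. *)
Lemma mass_le (a B r n k : R) : 0 < r ->
  a * (((2 * (c * r)) `^ n * r `^ k) `^ p^-1) <= B ->
  a <= (2 * c) `^ (- (n / p)) * r `^ (- ((n + k) / p)) * B.
Proof.
move=> r0 H.
have c20 : 0 < 2 * c by rewrite mulr_gt0.
have E : ((2 * (c * r)) `^ n * r `^ k) `^ p^-1 = (2 * c) `^ (n / p) * r `^ ((n + k) / p).
  rewrite mulrA [(2 * c * r) `^ n]powRM ?(ltW c20) ?(ltW r0)// -mulrA -powRD_gt0//.
  by rewrite powRM ?powR_ge0// -!powRrM.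
rewrite E mulrA -ler_pdivlMr ?powR_gt0// -ler_pdivlMr ?powR_gt0// in H.
by apply: le_trans H _; rewrite !powRN le_eqVlt; apply/orP; left; apply/eqP; ring.
Qed.

Lemma in_Lp_measurable u : in_Lp Omega T p u -> measurable_fun setT (cyl_fun Omega T u).
Proof. by move=> /sub_Lfun_mfun; rewrite inE. Qed.

(** The volume (2 c r)^N r^2 of a box in space-time, to the power -1 / p, yields both the constant
    and the exponent. *)
Lemma local_mass_cyl u : in_Lp Omega T p u ->
  local_mass Omega T c ((2 * c) `^ (- (N%:R / p))) ((N%:R + 2) / p) u (fine (Lp_norm Omega T p u)).
Proof.
move=> uLp x x' t r a [Ox tT] box r0 rT a0 H.
have Lfin : (Lp_norm Omega T p u < +oo)%E.
  by have := sub_Lfun_finLfun uLp; rewrite inE.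
have Lge0 : (0 <= Lp_norm Omega T p u)%E by exact: Lnorm_ge0.
have cr0 : 0 < c * r by rewrite mulr_gt0.
have cr2 : 0 <= 2 * (c * r) by rewrite mulr_ge0// ltW.
move: tT; rewrite /= in_itv /= => /andP[t0 t1].
have r20 : 0 < r ^+ 2 by rewrite exprn_gt0.
(* A time interval of length r^2 that starts or ends at t, on the side where (0, T) has room. *)
have [b [bT bt]] : exists b, `[b, b + r ^+ 2]%classic `<=` `]0, T[%classic /\
    forall t', `[b, b + r ^+ 2]%classic t' -> `|t - t'| <= r ^+ 2.
  have [tl|tg] := leP t (T / 2).
    exists t; split=> t' /=; rewrite !in_itv /= => /andP[h1 h2]; first by lra.
    by rewrite ler0_norm; lra.
  exists (t - r ^+ 2); split=> t' /=; rewrite !in_itv /= => /andP[h1 h2]; first by lra.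
  by rewrite ger0_norm; lra.
set E := tuple_box (fun i => x' 0 i) (c * r) `*` `[b, b + r ^+ 2]%classic.
have mE : measurable E.
  by apply: measurableX; [exact: measurable_tuple_box|exact: measurable_itv].
have muE : (leb N \x @lebesgue_measure R)%E E = ((2 * (c * r)) `^ N%:R * r `^ 2)%:E.
  rewrite product_measure1E; [|exact: measurable_tuple_box|exact: measurable_itv].
  rewrite EFinM powR_mulrn//; congr (_ * _)%E.
    exact: leb_tuple_box.
  apply: etrans (lebesgue_measure_itv `[b, b + r ^+ 2]) _.
  by rewrite /= lte_fin ltrDl r20 -EFinB [b + _]addrC addrK -powR_mulrn ?(ltW r0).
have aE z : E z -> a <= `|cyl_fun Omega T u z|; last first.
  apply: (mass_le r0); rewrite -lee_fin fineK ?ge0_fin_numE// EFinM -poweR_EFin -muE.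
  exact: Lnorm_ge (in_Lp_measurable uLp) mE p_gt0 a0 aE.
case: z => y t' [/= yb tb].
have yx : `|row_of_tuple y - x'| <= c * r by apply: row_box => //; exact: ltW.
have cy : cyl Omega T (row_of_tuple y, t') by split; [exact: box|exact: bT].
by rewrite /cyl_fun patchE mem_set//=; apply: H => //; exact: bt.
Qed.

(** Only the time t' = t is used, so the box has volume (2 c r)^N and the exponent loses its 2 /
    p. *)
Lemma local_mass_slice u : in_Lp Omega T p u -> 0 < T -> (sup_Lp_norm Omega T p u < +oo)%E ->
  0 <= fine (sup_Lp_norm Omega T p u) /\
  sup_Lp_norm Omega T p u \is a fin_num /\
  local_mass Omega T c ((2 * c) `^ (- (N%:R / p))) (N%:R / p) u (fine (sup_Lp_norm Omega T p u)).
Proof.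
move=> uLp T0 fin.
have ge0 : (0 <= sup_Lp_norm Omega T p u)%E.
  apply: le_trans (ereal_sup_ubound _); last first.
    by exists (T / 2); [rewrite /= in_itv /=; lra|reflexivity].
  exact: Lnorm_ge0.
have finn : sup_Lp_norm Omega T p u \is a fin_num by rewrite ge0_fin_numE.
split; first exact: fine_ge0.
split=> // x x' t r a cx box r0 rT a0 H.
have cr0 : 0 < c * r by rewrite mulr_gt0.
have cr2 : 0 <= 2 * (c * r) by rewrite mulr_ge0// ltW.
set E := tuple_box (fun i => x' 0 i) (c * r).
have mE : measurable E by exact: measurable_tuple_box.
have [Ox tT] := cx.
(* A slice of a function that is measurable on the product is measurable. *)
have mslice : measurable_fun setT (slice_fun Omega u t).
  have -> : slice_fun Omega u t = fun y => cyl_fun Omega T u (y, t).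
    apply/funext => y; rewrite /slice_fun /cyl_fun !patchE /=.
    by congr (if _ then _ else _); apply/idP/idP; rewrite !inE; [move=> Oy; split|case].
  exact: measurableT_comp (in_Lp_measurable uLp) (pair2_measurable _).
have lE : leb N E = ((2 * (c * r)) ^+ N)%:E by exact: leb_tuple_box.
have aE y : E y -> a <= `|slice_fun Omega u t y|.
  move=> yb; have yx : `|row_of_tuple y - x'| <= c * r by apply: row_box => //; exact: ltW.
  have Oy := box _ yx.
  rewrite /slice_fun patchE mem_set//=; apply: H => //.
  by rewrite subrr normr0 exprn_ge0// ltW.
have le_sup : ('N[leb N]_p%:E[EFin \o slice_fun Omega u t] <= sup_Lp_norm Omega T p u)%E.
  by apply: ereal_sup_ubound; exists t.
have H2 : a * ((2 * (c * r)) ^+ N) `^ p^-1 <= fine (sup_Lp_norm Omega T p u).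
  rewrite -lee_fin fineK// EFinM -poweR_EFin -lE; apply: le_trans le_sup.
  exact: Lnorm_ge mslice mE p_gt0 a0 aE.
have := @mass_le a (fine (sup_Lp_norm Omega T p u)) r N%:R 0 r0.
rewrite addr0 powRr0 mulr1 powR_mulrn//; exact.
Qed.

End lebesgue_local_mass.

(** * The closed cylinder *)

Section limits_on_closed_cylinder.
Context {R : realType} {N : nat}.

Lemma enorm_continuous : continuous (@enorm R N).
Proof.
have sum_cont : continuous (fun x : 'rV[R]_N => \sum_i (x 0 i) ^+ 2).
  apply: continuous_big => [|i _ x]; first exact: add_continuous.
  apply: (@continuous_comp _ _ _ (fun x : 'rV[R]_N => x 0 i) (fun y => y ^+ 2)).
    exact: coord_continuous.
  exact: exprn_continuous.
move=> x; apply: (@continuous_comp _ _ _ _ Num.sqrt); first exact: sum_cont.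
exact: sqrt_continuous.
Qed.

Lemma powR_continuous_gt0 (b x : R) : 0 < x -> {for x, continuous (fun y : R => y `^ b)}.
Proof.
move=> x0; apply: differentiable_continuous; apply/derivable1_diffP.
by apply: derivable_powR; rewrite in_itv /= x0.
Qed.

Variables (Omega : set 'rV[R]_N) (T : R).
Hypothesis T_gt0 : 0 < T.

Local Notation I := `]0, T[%classic.

Lemma closure_open_itv t : `[0, T]%classic t -> closure I t.
Proof.
rewrite /= in_itv /= => /andP[t0 t1] B /nbhs_ballP[e /= e0 eB].
pose d := Num.min (e / 2) (T / 2).
have d0 : 0 < d by rewrite lt_min !divr_gt0.
have [de dT] : d <= e / 2 /\ d <= T / 2 by rewrite /d !ge_min !lexx orbT.
have [tl|tg] := leP t (T / 2).
  exists (t + d / 2); split; first by rewrite /= in_itv /=; lra.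
  by apply: eB; rewrite -ball_normE /= opprD addrA subrr add0r normrN gtr0_norm; lra.
exists (t - d / 2); split; first by rewrite /= in_itv /=; lra.
by apply: eB; rewrite -ball_normE /= opprB addrCA subrr addr0 gtr0_norm; lra.
Qed.

Lemma cvg_within_cyl (S : Type) (F : set_system S) {FF : Filter F}
    (f : S -> 'rV[R]_N) (g : S -> R) (x : 'rV[R]_N) (t : R) :
  f @ F --> within Omega (nbhs x) -> g @ F --> within I (nbhs t) ->
  (fun s => (f s, g s)) @ F --> within (cyl Omega T) (nbhs (x, t)).
Proof.
move=> fx gt P nP.
have fx' : f @ F --> x by move=> U Ux; apply: fx; exact: cvg_within.
have gt' : g @ F --> t by move=> U Ux; apply: gt; exact: cvg_within.
have fO : F (f @^-1` Omega) by apply: fx; apply: withinT.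
have gI : F (g @^-1` I) by apply: gt; apply: withinT.
have pr : (fun s => (f s, g s)) @ F --> (x, t) := cvg_pair fx' gt'.
have Q : F (fun s => cyl Omega T (f s, g s) -> P (f s, g s)) := pr FF (nbhs_filter x) (nbhs_filter t) _ nP.
change (F (fun s => P (f s, g s))).
by apply: filterS3 fO gI Q => s Os Is; apply; split.
Qed.

Lemma ccyl_within_proper z : ccyl Omega T z -> ProperFilter (within (cyl Omega T) (nbhs z)).
Proof.
case: z => x t [/= cx ct].
have FO : ProperFilter (within Omega (nbhs x)) by exact: within_nbhs_proper.
have FI : ProperFilter (within I (nbhs t)).
  by apply: within_nbhs_proper; exact: closure_open_itv.
have := @cvg_within_cyl _ (filter_prod (within Omega (nbhs x)) (within I (nbhs t))) _
  fst snd x t cvg_fst cvg_snd => C.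
apply: Build_ProperFilter_ex => P /C /filter_ex[s Ps]; by exists s.
Qed.

Variable w v : 'rV[R]_N * R -> R.
Hypothesis w_cvg : forall z, ccyl Omega T z -> w @ within (cyl Omega T) (nbhs z) --> v z.

Lemma sup_ccyl X : (forall z, cyl Omega T z -> `|w z| <= X) ->
  forall z, ccyl Omega T z -> `|v z| <= X.
Proof.
move=> wX z cz; have PF := ccyl_within_proper cz.
apply: (cvgr_to_le (cvg_norm (w_cvg cz))).
by have := withinT (cyl Omega T) (nbhs_filter z); apply: filterS => y; exact: wX.
Qed.

(** The two space variables tend to x and y independently but share their time, hence a product of
    three filters. Since x != y, the distance stays away from 0, where its power b is continuous. *)
Lemma hoelder_x_ccyl X b : 0 <= X ->
  (forall x y t, cyl Omega T (x, t) -> cyl Omega T (y, t) ->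
    `|w (x, t) - w (y, t)| <= X * enorm (x - y) `^ b) ->
  forall x y t, x != y -> ccyl Omega T (x, t) -> ccyl Omega T (y, t) ->
    `|v (x, t) - v (y, t)| <= X * enorm (x - y) `^ b.
Proof.
move=> X0 wX x y t xy cx cy.
have [/= Ox It] := cx; have [/= Oy _] := cy.
have FO : ProperFilter (within Omega (nbhs x)) by exact: within_nbhs_proper.
have FO' : ProperFilter (within Omega (nbhs y)) by exact: within_nbhs_proper.
have FI : ProperFilter (within I (nbhs t)).
  by apply: within_nbhs_proper; exact: closure_open_itv.
set F := filter_prod (filter_prod (within Omega (nbhs x)) (within Omega (nbhs y)))
  (within I (nbhs t)).
have PF : ProperFilter F by apply: filter_prod_proper; exact: filter_prod_proper.
have p1 : (fun s : ('rV[R]_N * 'rV[R]_N) * R => s.1.1) @ F --> within Omega (nbhs x).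
  by apply: cvg_comp cvg_fst _; exact: cvg_fst.
have p2 : (fun s : ('rV[R]_N * 'rV[R]_N) * R => s.1.2) @ F --> within Omega (nbhs y).
  by apply: cvg_comp cvg_fst _; exact: cvg_snd.
have p3 : snd @ F --> within I (nbhs t) by exact: cvg_snd.
have c1 : (fun s : 'rV[R]_N * 'rV[R]_N * R => w (s.1.1, s.2)) @ F --> v (x, t).
  by apply: cvg_comp (cvg_within_cyl p1 p3) (w_cvg cx).
have c2 : (fun s : 'rV[R]_N * 'rV[R]_N * R => w (s.1.2, s.2)) @ F --> v (y, t).
  by apply: cvg_comp (cvg_within_cyl p2 p3) (w_cvg cy).
have cL : (fun s : 'rV[R]_N * 'rV[R]_N * R => `|w (s.1.1, s.2) - w (s.1.2, s.2)|) @ F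
    --> `|v (x, t) - v (y, t)| by apply: cvg_norm; exact: cvgB.
have exy : 0 < enorm (x - y).
  by apply: lt_le_trans (norm_le_enorm _); rewrite normr_gt0 subr_eq0.
have p1' : (fun s : 'rV[R]_N * 'rV[R]_N * R => s.1.1) @ F --> x.
  by apply: cvg_trans p1 _; exact: cvg_within.
have p2' : (fun s : 'rV[R]_N * 'rV[R]_N * R => s.1.2) @ F --> y.
  by apply: cvg_trans p2 _; exact: cvg_within.
have cE : (fun s : 'rV[R]_N * 'rV[R]_N * R => enorm (s.1.1 - s.1.2)) @ F --> enorm (x - y).
  by apply: continuous_cvg (@enorm_continuous (x - y)) _; exact: cvgB.
have cR : (fun s : 'rV[R]_N * 'rV[R]_N * R => X * enorm (s.1.1 - s.1.2) `^ b) @ F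
    --> X * enorm (x - y) `^ b.
  have cP := @continuous_cvg _ _ _ F _ _ (fun y : R => y `^ b) _ (powR_continuous_gt0 exy) cE.
  by apply: cvgM; [exact: cvg_cst|exact: cP].
rewrite -subr_le0; apply: (cvgr_to_le (cvgB cL cR)).
have i1 : F (fun s => Omega s.1.1) by apply: p1; apply: withinT.
have i2 : F (fun s => Omega s.1.2) by apply: p2; apply: withinT.
have i3 : F (fun s => I s.2) by apply: p3; apply: withinT.
apply: filterS3 i1 i2 i3 => s O1 O2 I3.
by rewrite /= subr_le0; apply: wX; split.
Qed.

Lemma hoelder_t_ccyl X b : 0 <= X ->
  (forall x t t', cyl Omega T (x, t) -> cyl Omega T (x, t') ->
    `|w (x, t) - w (x, t')| <= X * `|t - t'| `^ b) ->
  forall x t t', t != t' -> ccyl Omega T (x, t) -> ccyl Omega T (x, t') ->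
    `|v (x, t) - v (x, t')| <= X * `|t - t'| `^ b.
Proof.
move=> X0 wX x t t' tt cx cy.
have [/= Ox It] := cx; have [/= _ It'] := cy.
have FO : ProperFilter (within Omega (nbhs x)) by exact: within_nbhs_proper.
have FI : ProperFilter (within I (nbhs t)).
  by apply: within_nbhs_proper; exact: closure_open_itv.
have FI' : ProperFilter (within I (nbhs t')).
  by apply: within_nbhs_proper; exact: closure_open_itv.
set F := filter_prod (within Omega (nbhs x))
  (filter_prod (within I (nbhs t)) (within I (nbhs t'))).
have PF : ProperFilter F by apply: filter_prod_proper; exact: filter_prod_proper.
have p1 : fst @ F --> within Omega (nbhs x) by exact: cvg_fst.
have p2 : (fun s : 'rV[R]_N * (R * R) => s.2.1) @ F --> within I (nbhs t).
  by apply: cvg_comp cvg_snd _; exact: cvg_fst.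
have p3 : (fun s : 'rV[R]_N * (R * R) => s.2.2) @ F --> within I (nbhs t').
  by apply: cvg_comp cvg_snd _; exact: cvg_snd.
have c1 : (fun s : 'rV[R]_N * (R * R) => w (s.1, s.2.1)) @ F --> v (x, t).
  by apply: cvg_comp (cvg_within_cyl p1 p2) (w_cvg cx).
have c2 : (fun s : 'rV[R]_N * (R * R) => w (s.1, s.2.2)) @ F --> v (x, t').
  by apply: cvg_comp (cvg_within_cyl p1 p3) (w_cvg cy).
have cL : (fun s : 'rV[R]_N * (R * R) => `|w (s.1, s.2.1) - w (s.1, s.2.2)|) @ F
    --> `|v (x, t) - v (x, t')| by apply: cvg_norm; exact: cvgB.
have exy : 0 < `|t - t'| by rewrite normr_gt0 subr_eq0.
have p2' : (fun s : 'rV[R]_N * (R * R) => s.2.1) @ F --> t.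
  by apply: cvg_trans p2 _; exact: cvg_within.
have p3' : (fun s : 'rV[R]_N * (R * R) => s.2.2) @ F --> t'.
  by apply: cvg_trans p3 _; exact: cvg_within.
have cE : (fun s : 'rV[R]_N * (R * R) => `|s.2.1 - s.2.2|) @ F --> `|t - t'|.
  by apply: cvg_norm; exact: cvgB.
have cR : (fun s : 'rV[R]_N * (R * R) => X * `|s.2.1 - s.2.2| `^ b) @ F
    --> X * `|t - t'| `^ b.
  have cP := @continuous_cvg _ _ _ F _ _ (fun y : R => y `^ b) _ (powR_continuous_gt0 exy) cE.
  by apply: cvgM; [exact: cvg_cst|exact: cP].
rewrite -subr_le0; apply: (cvgr_to_le (cvgB cL cR)).
have i1 : F (fun s => Omega s.1) by apply: p1; apply: withinT.
have i2 : F (fun s => I s.2.1) by apply: p2; apply: withinT.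
have i3 : F (fun s => I s.2.2) by apply: p3; apply: withinT.
apply: filterS3 i1 i2 i3 => s O1 O2 I3.
by rewrite /= subr_le0; apply: wX; split.
Qed.

End limits_on_closed_cylinder.

Lemma sum2_ge_term {R : realType} (I J : finType) (P : I -> pred J) (F : I -> J -> \bar R) i j :
  P i j -> (forall i j, 0 <= F i j)%E -> (F i j <= \sum_i \sum_(j | P i j) F i j)%E.
Proof.
move=> Pij F0; apply: le_trans (@le_bigsum_ge0 _ _ (P i) (F i) j Pij _) _ => //.
apply: (@le_bigsum_ge0 _ _ xpredT (fun i => \sum_(j | P i j) F i j)%E) => // i' _.
exact: sume_ge0.
Qed.

Lemma sum2_le {R : realType} (I J : finType) (P : I -> pred J) (F : I -> J -> \bar R) (X : R) :
  0 <= X -> (forall i j, P i j -> F i j <= X%:E)%E ->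
  (\sum_i \sum_(j | P i j) F i j <= ((#|I| * #|J|)%:R * X)%:E)%E.
Proof.
move=> X0 FX; apply: (@le_trans _ _ (\sum_(i : I) \sum_(j : J) X%:E)%E).
  apply: lee_sum => i _; rewrite [leRHS](bigID (P i))/= -[leLHS]adde0.
  apply: leeD; first by apply: lee_sum => j; exact: FX.
  by apply: sume_ge0 => j _; rewrite lee_fin.
under eq_bigr do rewrite sumEFin.
by rewrite sumEFin !sumr_const -mulrnA mulnC mulr_natl.
Qed.

(** * The parabolic norm and its individual terms *)

Section parabolic_norm.
Context {R : realType} {N : nat}.
Variables (Omega : set 'rV[R]_N) (T : R) (m : nat) (u : 'rV[R]_N * R -> R).
Hypotheses (N_gt0 : (0 < N)%N) (T_gt0 : 0 < T) (oOmega : open Omega) (Omega0 : Omega !=set0).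
Hypothesis Cu : C_par Omega T m u.
Implicit Types (l X : R) (j : nat) (beta : 'I_N -> nat).

Local Notation srt := (sorted (@ole N)).

Lemma Dtx_cvg j beta z : (par_order j beta <= m)%N -> ccyl Omega T z ->
  jderiv u j (idx_seq beta) @ within (cyl Omega T) (nbhs z) --> Dtx Omega T j beta u z.
Proof.
move=> km cz; rewrite /jderiv -par_dirsE; have [_ _ c] := proj2 Cu j beta km.
exact: c.
Qed.

Lemma cyl_sub_ccyl z : cyl Omega T z -> ccyl Omega T z.
Proof.
case=> O I; split; first exact: subset_closure.
by move: I; rewrite /= !in_itv /= => /andP[a b]; rewrite !ltW.
Qed.

Lemma Dtx_cyl j beta z : (par_order j beta <= m)%N -> cyl Omega T z ->
  Dtx Omega T j beta u z = jderiv u j (idx_seq beta) z.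
Proof.
move=> km cz; have PF := ccyl_within_proper T_gt0 (cyl_sub_ccyl cz).
have [_ c _] := proj2 Cu j beta km.
rewrite /Dtx /jderiv -par_dirsE; apply/cvg_lim => //.
apply: cvg_within_filter; exact: c.
Qed.

Lemma ccyl_nonempty : exists z, ccyl Omega T z.
Proof.
have [x Ox] := Omega0; exists (x, 0); split; first exact: subset_closure.
by rewrite /= in_itv /= lexx ltW.
Qed.

Lemma sup_cyl_ge0 w : (0 <= sup_cyl Omega T w)%E.
Proof.
have [z cz] := ccyl_nonempty.
by apply: le_trans (ereal_sup_ubound _); last by exists z; [exact: cz|reflexivity].
Qed.

(** A supremum over no pairs would be -oo: two distinct points of the open set are needed, and N > 0
    provides a direction. *)
Lemma hoelder_x_ge0 b w : (0 <= hoelder_x Omega T b w)%E.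
Proof.
have [x Ox] := Omega0.
have /nbhs_ballP[e /= e0 eO] : nbhs x Omega by exact: open_nbhs_nbhs.
pose v : 'rV[R]_N := (e / 2) *: delta_mx 0 (Ordinal N_gt0).
have v0 : v != 0.
  apply/eqP => /rowP /(_ (Ordinal N_gt0)); rewrite !mxE !eqxx mulr1 => /eqP.
  by rewrite gt_eqF// divr_gt0.
have Oy : Omega (x + v).
  apply: eO; rewrite -ball_normE /= opprD addrA subrr add0r normrN normrZ.
  rewrite gtr0_norm ?divr_gt0//; apply: (@le_lt_trans _ _ (e / 2 * 1)); last by lra.
  by rewrite ler_wpM2l ?norm_delta_mx// divr_ge0// ltW.
have I0 : `[0, T]%classic 0 by rewrite /= in_itv /= lexx ltW.
apply: le_trans (ereal_sup_ubound _); last first.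
  exists (x, x + v, 0); last reflexivity.
  split=> /=; [by split => //; exact: subset_closure|by split => //; exact: subset_closure|].
  by rewrite -subr_eq0 opprD addrA subrr add0r oppr_eq0.
by rewrite lee_fin divr_ge0// powR_ge0.
Qed.

Lemma hoelder_t_ge0 b w : (0 <= hoelder_t Omega T b w)%E.
Proof.
have [x Ox] := Omega0.
apply: le_trans (ereal_sup_ubound _); last first.
  exists (x, (0, T)); last reflexivity.
  split=> /=; [| |by rewrite lt_eqF].
    by split; [exact: subset_closure|rewrite /= in_itv /= lexx ltW].
  by split; [exact: subset_closure|rewrite /= in_itv /= lexx ltW].
by rewrite lee_fin divr_ge0// powR_ge0.
Qed.

Lemma par_norm_int_ge0 k : (0 <= par_norm_int Omega T k u)%E.
Proof. by apply: sume_ge0 => beta _; apply: sume_ge0 => j _; exact: sup_cyl_ge0. Qed.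

Lemma par_hoelder_x_ge0 k b : (0 <= par_hoelder_x Omega T k b u)%E.
Proof. by apply: sume_ge0 => beta _; apply: sume_ge0 => j _; exact: hoelder_x_ge0. Qed.

Lemma par_hoelder_t_ge0 k b : (0 <= par_hoelder_t Omega T k b u)%E.
Proof. by apply: sume_ge0 => beta _; apply: sume_ge0 => j _; exact: hoelder_t_ge0. Qed.

Lemma par_norm_ge0 l : (0 <= par_norm Omega T l u)%E.
Proof.
rewrite /par_norm; case: ifP => _; rewrite ?adde_ge0 ?par_norm_int_ge0//.
  exact: par_hoelder_x_ge0.
exact: par_hoelder_t_ge0.
Qed.

Lemma par_order_count k j s : srt s -> (size s + 2 * j <= k)%N ->
  exists (beta : multiindex N k) (j' : 'I_k.+1),
    [/\ par_order j' (entries beta) = (size s + 2 * j)%N, idx_seq (entries beta) = s & j' = j :> nat].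
Proof.
move=> ss sk; have [|beta bE] := @entries_count N k s; first by move: sk; lia.
have jk : (j < k.+1)%N by move: sk; lia.
by exists beta, (Ordinal jk); rewrite /par_order bE msize_count idx_seq_count.
Qed.

Lemma par_norm_order_bounds l : l \isn't a Num.int -> m = Num.truncn l ->
  (par_norm Omega T l u < +oo)%E -> order_bounds Omega T l u (fine (par_norm Omega T l u)).
Proof.
move=> li mE fin.
have AE : (fine (par_norm Omega T l u))%:E = par_norm Omega T l u.
  by rewrite fineK// ge0_fin_numE// par_norm_ge0.
set A := fine _ in AE *.
have A0 : 0 <= A by rewrite -lee_fin AE par_norm_ge0.
rewrite /par_norm (negbTE li) -mE in AE.
have n0 := par_norm_int_ge0 m; have x0 := par_hoelder_x_ge0 m (l - m%:R).
have t0 := par_hoelder_t_ge0 m (l - m%:R).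
have nA : (par_norm_int Omega T m u <= A%:E)%E by rewrite AE -addeA leeDl// adde_ge0.
have xA : (par_hoelder_x Omega T m (l - m%:R) u <= A%:E)%E.
  by rewrite AE addeAC leeDr// adde_ge0.
have tA : (par_hoelder_t Omega T m (l - m%:R) u <= A%:E)%E by rewrite AE leeDr// adde_ge0.
rewrite /order_bounds -mE; split=> [j s z ss sm cz|_ j s x y t ss|_ j s x t t' ss].
- have [beta [j' [ord idx jj]]] := par_order_count ss sm.
  have Db : Dtx Omega T j' (entries beta) u z = jderiv u j s z.
    by rewrite Dtx_cyl ?ord// idx jj.
  rewrite -Db -lee_fin; apply: le_trans nA.
  apply: (@le_trans _ _ (sup_cyl Omega T (Dtx Omega T j' (entries beta) u))).
    by apply: ereal_sup_ubound; exists z => //; exact: cyl_sub_ccyl.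
  apply: (@sum2_ge_term _ _ _
    (fun (beta : multiindex N m) (j : 'I_m.+1) => (par_order j (entries beta) <= m)%N)
    (fun (beta : multiindex N m) (j : 'I_m.+1) => sup_cyl Omega T (Dtx Omega T j (entries beta) u)) beta j').
    by rewrite ord.
  by move=> *; exact: sup_cyl_ge0.
- move=> /andP[sm sm1] cx cy.
  have [->|xy] := eqVneq x y.
    by rewrite !subrr normr0 mulr_ge0// powR_ge0.
  have [beta [j' [ord idx jj]]] := par_order_count ss sm.
  have Db z : cyl Omega T z -> Dtx Omega T j' (entries beta) u z = jderiv u j s z.
    by move=> cz; rewrite Dtx_cyl ?ord// idx jj.
  have exy : 0 < enorm (x - y).
    by apply: lt_le_trans (norm_le_enorm _); rewrite normr_gt0 subr_eq0.
  rewrite -!Db// -ler_pdivrMr ?powR_gt0// -lee_fin; apply: le_trans xA.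
  apply: (@le_trans _ _ (hoelder_x Omega T (l - m%:R) (Dtx Omega T j' (entries beta) u))).
    apply: ereal_sup_ubound; exists (x, y, t) => //.
    by split=> //; exact: cyl_sub_ccyl.
  apply: (@sum2_ge_term _ _ _ (fun (beta : multiindex N m) (j : 'I_m.+1) =>
      (par_order j (entries beta) <= m <= (par_order j (entries beta)).+1)%N)
    (fun (beta : multiindex N m) (j : 'I_m.+1) =>
      hoelder_x Omega T (l - m%:R) (Dtx Omega T j (entries beta) u)) beta j').
    by rewrite ord sm.
  by move=> *; exact: hoelder_x_ge0.
- move=> /andP[sm sm1] cx cy.
  have [beta [j' [ord idx jj]]] := par_order_count ss sm.
  rewrite -ord; set b := (_ / 2).
  have [->|tt] := eqVneq t t'.
    by rewrite !subrr normr0 mulr_ge0// powR_ge0.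
  have Db z : cyl Omega T z -> Dtx Omega T j' (entries beta) u z = jderiv u j s z.
    by move=> cz; rewrite Dtx_cyl ?ord// idx jj.
  have exy : 0 < `|t - t'| by rewrite normr_gt0 subr_eq0.
  rewrite -!Db// -ler_pdivrMr ?powR_gt0// -lee_fin; apply: le_trans tA.
  apply: (@le_trans _ _ (hoelder_t Omega T b (Dtx Omega T j' (entries beta) u))).
    apply: ereal_sup_ubound; exists (x, (t, t')) => //.
    by split=> //; exact: cyl_sub_ccyl.
  apply: (@sum2_ge_term _ _ _ (fun (beta : multiindex N m) (j : 'I_m.+1) =>
      (par_order j (entries beta) <= m <= (par_order j (entries beta)).+1)%N)
    (fun (beta : multiindex N m) (j : 'I_m.+1) =>
      hoelder_t Omega T (((m - par_order j (entries beta))%:R + (l - m%:R)) / 2)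
        (Dtx Omega T j (entries beta) u)) beta j').
    by rewrite ord sm.
  by move=> *; exact: hoelder_t_ge0.
Qed.

(** The factor 3 counts the sum of suprema and the two seminorms; in each, the number of terms is
    bounded by that of all pairs (beta, j). *)
Lemma order_bounds_par_norm l X : (Num.truncn l <= m)%N -> 0 <= X ->
  order_bounds Omega T l u X ->
  (par_norm Omega T l u <=
    (3 * ((#|{: multiindex N (Num.truncn l)}| * #|'I_(Num.truncn l).+1|)%:R * X))%:E)%E.
Proof.
move=> km X0; set k := Num.truncn l in km *; rewrite /order_bounds -/k => -[b1 b2 b3].
set n := (_ * _)%:R * X.
have n0 : 0 <= n by rewrite mulr_ge0.
have ordE j (beta : multiindex N k) : (size (idx_seq (entries beta)) + 2 * j)%N = par_order j (entries beta).
  by rewrite size_idx_seq.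
have intX : (par_norm_int Omega T k u <= n%:E)%E.
  apply: sum2_le => // beta j bj; apply: ge_ereal_sup => _ [z cz <-].
  rewrite lee_fin; apply: (sup_ccyl T_gt0 (w := jderiv u j (idx_seq (entries beta)))) => //.
    by move=> z' cz'; apply: Dtx_cvg => //; exact: leq_trans bj km.
    by move=> z' cz'; apply: b1; [exact: sorted_idx_seq|rewrite ordE|].
  exact: cz.
have [li|li] := boolP (l \is a Num.int).
  rewrite /par_norm li -/k.
  by apply: le_trans intX _; rewrite lee_fin; lra.
rewrite /par_norm (negbTE li) -/k.
have -> : (3 * n)%:E = (n%:E + n%:E + n%:E)%E by rewrite -!EFinD (_ : 3 * n = n + n + n)//; ring.
apply: leeD; first apply: leeD => //.
- apply: sum2_le => // beta j bj; have /andP[bj1 bj2] := bj.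
  apply: ge_ereal_sup => _ [[[x y] t] /= [cx cy xy] <-].
  have exy : 0 < enorm (x - y).
    by apply: lt_le_trans (norm_le_enorm _); rewrite normr_gt0 subr_eq0.
  rewrite lee_fin ler_pdivrMr ?powR_gt0//.
  apply: (hoelder_x_ccyl T_gt0 (w := jderiv u j (idx_seq (entries beta)))) => //.
  - by move=> z' cz'; apply: Dtx_cvg => //; exact: leq_trans bj1 km.
  - by move=> x' y' t' cx' cy'; apply: b2; rewrite ?ordE//; exact: sorted_idx_seq.
  - exact: cx.
  - exact: cy.
- apply: sum2_le => // beta j bj; have /andP[bj1 bj2] := bj.
  apply: ge_ereal_sup => _ [[x [t t']] /= [cx cy tt] <-].
  have exy : 0 < `|t - t'| by rewrite normr_gt0 subr_eq0.
  rewrite lee_fin ler_pdivrMr ?powR_gt0//.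
  apply: (hoelder_t_ccyl T_gt0 (w := jderiv u j (idx_seq (entries beta)))) => //.
  - by move=> z' cz'; apply: Dtx_cvg => //; exact: leq_trans bj1 km.
  - by move=> x' s s' cx' cy'; rewrite -ordE; apply: b3; rewrite ?ordE//; exact: sorted_idx_seq.
  - exact: cx.
  - exact: cy.
Qed.

End parabolic_norm.

Theorem theorem2 (R : realType) (N : nat) (p T l1 l2 : R) (Omega : set 'rV[R]_N)
    (N_gt0 : (0 < N)%N) (p_gt1 : 1 < p) (T_gt0 : 0 < T)
    (l1_gt0 : 0 < l1) (l1_lt_l2 : l1 < l2) (l2_nint : l2 \isn't a Num.int)
    (Omega_domain : domain Omega) (Omega_smooth : smooth_boundary l2 Omega) :
  exists C : R, 0 < C /\
  forall u : 'rV[R]_N * R -> R,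
    C_par_hoelder Omega T l2 u -> in_Lp Omega T p u ->
    (let omega := (p * l1 + N%:R + 2) / (p * l2 + N%:R + 2) in
     (par_norm Omega T l1 u <=
        C%:E * par_norm Omega T l2 u `^ omega
             * Lp_norm Omega T p u `^ (1 - omega))%E)
    /\
    ((sup_Lp_norm Omega T p u < +oo)%E ->
     let sigma := (p * l1 + N%:R) / (p * l2 + N%:R) in
     (par_norm Omega T l1 u <=
        C%:E * par_norm Omega T l2 u `^ sigma
             * sup_Lp_norm Omega T p u `^ (1 - sigma))%E).
Proof.
have [oO _ O0] := Omega_domain.
have [r0 [c [r00 c0 c1 cone]]] := smooth_boundary_cone N_gt0 oO Omega_smooth.
have p0 : 0 < p by exact: lt_trans p_gt1.
have l20 : 0 < l2 by exact: lt_trans l1_lt_l2.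
have K0 : 0 <= (2 * c) `^ (- (N%:R / p)) by exact: powR_ge0.
have d0 : 0 <= (N%:R + 2) / p by rewrite divr_ge0 ?addr_ge0// ltW.
have d0' : 0 <= N%:R / p by rewrite divr_ge0// ltW.
have [C1 C10 H1] := order_bounds_interpolation r00 c0 c1 N_gt0 T_gt0 l1_gt0 l1_lt_l2
  l2_nint oO cone K0 d0.
have [C2 C20 H2] := order_bounds_interpolation r00 c0 c1 N_gt0 T_gt0 l1_gt0 l1_lt_l2
  l2_nint oO cone K0 d0'.
set k : R := 3 * (#|{: multiindex N (Num.truncn l1)}| * #|'I_(Num.truncn l1).+1|)%:R.
have k0 : 0 <= k by rewrite mulr_ge0.
(* [C1] is for the norm over the cylinder and [C2] for the norms of slices; their sum serves both,
   and 1 ensures positivity. *)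
exists (1 + k * (C1 + C2)); split.
  by rewrite ltr_pwDl// mulr_ge0// addr_ge0// ltW.
move=> u [Cu fin] uLp.
have A0 := par_norm_ge0 u N_gt0 T_gt0 oO O0 l2.
have AE : (fine (par_norm Omega T l2 u))%:E = par_norm Omega T l2 u.
  by rewrite fineK// ge0_fin_numE.
have OA := par_norm_order_bounds N_gt0 T_gt0 oO O0 Cu l2_nint erefl fin.
have fA0 : 0 <= fine (par_norm Omega T l2 u) by exact: fine_ge0.
have m12 : (Num.truncn l1 <= Num.truncn l2)%N by apply: le_truncn; exact: ltW.
(* Dividing by p gives the form (l1 + d) / (l2 + d) of the interpolation, with d = q / p for q = N +
   2 or q = N. *)
have exponentE q : (p * l1 + q) / (p * l2 + q) = (l1 + q / p) / (l2 + q / p).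
  have E l : l + q / p = (p * l + q) / p by field; rewrite gt_eqF.
  by rewrite !E invf_div mulrA divfK// gt_eqF.
have concl C B s : 0 <= C -> C <= C1 + C2 -> 0 <= B ->
    order_bounds Omega T l1 u (C * fine (par_norm Omega T l2 u) `^ s * B `^ (1 - s)) ->
    (par_norm Omega T l1 u <=
      (1 + k * (C1 + C2))%:E * par_norm Omega T l2 u `^ s * B%:E `^ (1 - s))%E.
  move=> C0 CC B0 OX.
  have X0 : 0 <= fine (par_norm Omega T l2 u) `^ s * B `^ (1 - s).
    by rewrite mulr_ge0// powR_ge0.
  rewrite -mulrA in OX.
  apply: le_trans (order_bounds_par_norm T_gt0 Cu m12 (mulr_ge0 C0 X0) OX) _.
  rewrite -[in leRHS]AE !poweR_EFin -!EFinM lee_fin mulrA -/k.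
  rewrite mulrA -[leRHS]mulrA ler_wpM2r//.
  have : k * C <= k * (C1 + C2) by rewrite ler_wpM2l.
  by lra.
split.
  move=> omega.
  have BE : (fine (Lp_norm Omega T p u))%:E = Lp_norm Omega T p u.
    rewrite fineK// ge0_fin_numE ?Lnorm_ge0//.
    by have := sub_Lfun_finLfun uLp; rewrite inE.
  have B0 : 0 <= fine (Lp_norm Omega T p u) by apply: fine_ge0; exact: Lnorm_ge0.
  have oE : omega = (l1 + (N%:R + 2) / p) / (l2 + (N%:R + 2) / p).
    by rewrite /omega -!addrA exponentE.
  rewrite -BE oE; apply: (concl C1) => //; [exact: ltW|by rewrite lerDl ltW|].
  apply: H1 => //; exact: local_mass_cyl.
move=> supfin; cbv zeta; rewrite exponentE.
have [B0 [Bfin mass]] := local_mass_slice c0 p0 uLp T_gt0 supfin.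
rewrite -(fineK Bfin); apply: (concl C2) => //; [exact: ltW|by rewrite lerDr ltW|].
exact: H2.
Qed.
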